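(* Let $0<\lambda<\pi/2$ and $f\in\mathscr{S}^*(e^{\lambda z})$. Then $$\|P_f\|\le\frac{(1-t_0^2)(e^{\lambda t_0}+\lambda t_0-1)}{t_0},$$ where $t_0$ is the unique root in $(0,1)$ of the equation $$1+r^2-2\lambda r^3-e^{\lambda r}(1-\lambda r+r^2+\lambda r^3)=0.$$
   Context: $\mathbb{D}=\{z\in\mathbb{C}:|z|<1\}$. $\mathscr{A}$ is the class of analytic functions $f$ on $\mathbb{D}$ with $f(0)=0$, $f'(0)=1$. For analytic $g,h$ on $\mathbb{D}$, $g\prec h$ (subordination) means $g=h\circ\omega$ for some analytic $\omega:\mathbb{D}\to\mathbb{D}$ with $\omega(0)=0$. $\mathscr{S}^*(e^{\lambda z})=\{f\in\mathscr{A}: zf'(z)/f(z)\prec e^{\lambda z}\}$. For $f\in\mathscr{A}$ with $f'\ne0$ in $\mathbb{D}$, $P_f(z)=f''(z)/f'(z)$ and $\|P_f\|=\sup_{z\in\mathbb{D}}(1-|z|^2)|P_f(z)|$. *)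

(* Defs.v *)
From Stdlib Require Import Reals Lra.
From Coquelicot Require Import Coquelicot.
Open Scope R_scope.

Definition unit_disk (z : C) : Prop := Cmod z < 1.

Definition Cexp (z : C) : C :=
  (exp (Re z) * cos (Im z), exp (Re z) * sin (Im z)).

(* Functions on a subset of C are total functions C -> C; only their values
   near the points under consideration matter. *)
Definition analytic_at (f : C -> C) (z0 : C) : Prop :=
  exists (a : nat -> C) (r : R), 0 < r /\
    forall z : C, Cmod (z - z0)%C < r ->
      @is_pseries C_AbsRing C_NormedModule a (z - z0)%C (f z).

Definition analytic_on (U : C -> Prop) (f : C -> C) : Prop :=
  forall z : C, U z -> analytic_at f z.

Definition class_A (f : C -> C) : Prop :=
  analytic_on unit_disk f /\ f 0%C = 0%C /\ C_derive f 0%C = 1%C.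

Definition subordinate (g h : C -> C) : Prop :=
  exists omega : C -> C,
    analytic_on unit_disk omega /\
    (forall z, unit_disk z -> unit_disk (omega z)) /\
    omega 0%C = 0%C /\
    (forall z, unit_disk z -> g z = h (omega z)).

(* z f'(z) / f(z), extended through its removable singularity at 0: the value
   there is 1 because f(0) = 0 and f'(0) = 1. *)
Definition starlike_quotient (f : C -> C) (z : C) : C :=
  if Ceq_dec z 0 then 1%C else (z * C_derive f z / f z)%C.

(* The second conjunct says that the quotient z f'(z) / f(z) is a genuine one
   away from 0. *)
Definition starlike_class (phi f : C -> C) : Prop :=
  class_A f /\
  (forall z, unit_disk z -> z <> 0%C -> f z <> 0%C) /\
  subordinate (starlike_quotient f) phi.

Definition starlike_exp (lambda : R) (f : C -> C) : Prop :=
  starlike_class (fun z => Cexp (lambda * z)%C) f.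

Definition pre_schwarzian (f : C -> C) (z : C) : C :=
  (C_derive (C_derive f) z / C_derive f z)%C.

(* The supremum is taken in the extended reals, so that it is +oo when the set
   is unbounded. *)
Definition pre_schwarzian_norm (f : C -> C) : Rbar :=
  Lub_Rbar (fun y : R => exists z : C, unit_disk z /\
    y = (1 - Cmod z ^ 2) * Cmod (pre_schwarzian f z)).

Lemma Cexp_neq_0 (z : C) : Cexp z <> 0%C.
Proof.
  intros H. injection H as H1 H2.
  pose proof (exp_pos (Re z)) as Hp.
  pose proof (sin2_cos2 (Im z)) as Hs. unfold Rsqr in Hs.
  apply Rmult_integral in H1. apply Rmult_integral in H2.
  destruct H1 as [H1|H1]; [lra|]. destruct H2 as [H2|H2]; [lra|].
  rewrite H1, H2 in Hs. lra.
Qed.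

(* Hence the pre-Schwarzian of a function in the class is a genuine quotient on
   the whole disk. *)
Lemma starlike_exp_derive_neq_0 (lambda : R) (f : C -> C) (z : C) :
  starlike_exp lambda f -> unit_disk z -> C_derive f z <> 0%C.
Proof.
  intros [[_ [_ Hf1]] [_ [omega [_ [_ [_ Hq]]]]]] Hz H.
  specialize (Hq z Hz). unfold starlike_quotient in Hq.
  destruct (Ceq_dec z 0) as [->|Hz0].
  - rewrite H in Hf1. injection Hf1 as Hf1. lra.
  - apply (Cexp_neq_0 (lambda * omega z)%C). rewrite <- Hq, H.
    unfold Cdiv. ring.
Qed.

(* Main.v *)
Require Import Defs.
From Stdlib Require Import Reals Lra Classical IndefiniteDescription.
From Coquelicot Require Import Coquelicot.
Open Scope R_scope.

(** The hypothesis reads z f'(z) / f(z) = exp (lambda w(z)) for an analytic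
    self-map w of the disk fixing 0.  Logarithmic differentiation gives
    P_f(z) = (exp (lambda w) - 1) / z + lambda w'(z), which is regrouped as
      P_f = (exp (lambda w) - 1) / z + lambda w / z + lambda (w' - w / z).
    With r = |z| and s = |w(z)|, the first two terms are at most
    (exp (lambda s) - 1 + lambda s) / r.  The last one is controlled by
    Dieudonne's lemma [dieudonne], |w' - w / z| <= (r^2 - s^2) / (r (1 - r^2)),
    which is the Schwarz-Pick inequality for w(z) / z.  Therefore
    (1 - r^2) |P_f(z)| <= G(r, s), where, with
    A(s) = exp (lambda s) + lambda s - 1,
      G(r, s) = ((1 - r^2) A(s) + lambda (r^2 - s^2)) / r.

    Because A(s) >= 2 lambda s, moving r down to s only increases G
    ([bound_le_diagonal]), so the diagonal value G(s, s) = [profile lambda s]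
    is an upper bound.  The derivative of [profile] is [critical] / t^2, and this
    ratio is strictly decreasing ([critical_ratio_decreasing]): hence [critical]
    has exactly one zero t0 in (0, 1), and [profile] is largest there.  The
    points with w(z) = 0, and z = 0 itself, give at most 2 lambda, the limit of
    [profile] at 0.  At z = 0 the formula for P_f is a limit; it is obtained by
    comparing the second Taylor coefficient of f with f''(0)
    ([C_derive_slope_at]).

    The complex analysis rests on finite Taylor expansions ([taylor]): they
    exist for convergent power series, they are stable under algebraic
    operations and division by z - a, and an expansion of order 3 is all that
    the maximum modulus principle needs, since |g|^2 + eps |z|^2 is then
    strictly subharmonic in a discrete sense ([no_local_max]). *)

(** * Finite Taylor expansions and complex derivatives *)

Lemma Cminus_eq_0 (z w : C) : (z - w = 0)%C -> z = w.
Proof.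
  intros H. replace z with ((z - w) + w)%C by ring. rewrite H. ring.
Qed.

Lemma Cminus_neq_0 (z w : C) : z <> w -> (z - w <> 0)%C.
Proof. intros H H0. apply H, Cminus_eq_0, H0. Qed.

Lemma Cmod_triangle_minus (z w : C) : Cmod z - Cmod w <= Cmod (z - w).
Proof.
  pose proof (Cmod_triangle (z - w) w) as H.
  replace (z - w + w)%C with z in H by ring. lra.
Qed.

Lemma Cmod_minus_sym (z w : C) : Cmod (z - w) = Cmod (w - z).
Proof. rewrite <- Cmod_opp. f_equal. ring. Qed.

(** Neighbourhoods for the modulus, as an instance of the filter [locally], whose
    closure properties are thereby inherited. *)
Definition near (z0 : C) (P : C -> Prop) : Prop :=
  @locally (AbsRing_UniformSpace C_AbsRing) z0 P.

Lemma near_intro (z0 : C) (P : C -> Prop) (d : R) :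
  0 < d -> (forall z, Cmod (z - z0) < d -> P z) -> near z0 P.
Proof. intros Hd H. exists (mkposreal d Hd). exact H. Qed.

Lemma near_elim (z0 : C) (P : C -> Prop) :
  near z0 P -> exists d, 0 < d /\ forall z, Cmod (z - z0) < d -> P z.
Proof. intros [d H]. exists d. split; [apply cond_pos|exact H]. Qed.

Lemma near_at (z0 : C) (P : C -> Prop) : near z0 P -> P z0.
Proof. apply locally_singleton. Qed.

Lemma near_and (z0 : C) (P Q : C -> Prop) :
  near z0 P -> near z0 Q -> near z0 (fun z => P z /\ Q z).
Proof. apply filter_and. Qed.

Lemma near_imp (z0 : C) (P Q : C -> Prop) :
  (forall z, P z -> Q z) -> near z0 P -> near z0 Q.
Proof. apply filter_imp. Qed.

Lemma near_all (z0 : C) (P : C -> Prop) : (forall z, P z) -> near z0 P.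
Proof. apply filter_forall. Qed.

Lemma near_unit_disk (z0 : C) : unit_disk z0 -> near z0 unit_disk.
Proof.
  unfold unit_disk. intros H. apply (near_intro _ _ (1 - Cmod z0)); [lra|].
  intros z Hz. pose proof (Cmod_triangle_minus z z0). lra.
Qed.

Lemma near_neq (z0 w : C) : z0 <> w -> near z0 (fun z => z <> w).
Proof.
  intros H. apply (near_intro _ _ (Cmod (z0 - w))).
  - apply Cmod_gt_0, Cminus_neq_0, H.
  - intros z Hz ->. rewrite Cmod_minus_sym in Hz. lra.
Qed.

(** An expansion g(z) = a_0 + ... + a_(n-1) h^(n-1) + O(h^n) with h = z - z0,
    written as n nested divided differences ending in a bounded function.  The
    nesting makes products, inverses and compositions follow by induction on n,
    with no manipulation of coefficients. *)
Fixpoint taylor (n : nat) (g : C -> C) (z0 : C) : Prop :=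
  match n with
  | O => exists B, near z0 (fun z => Cmod (g z) <= B)
  | S m => exists g1,
      near z0 (fun z => g z = (g z0 + (z - z0) * g1 z)%C) /\ taylor m g1 z0
  end.

Lemma taylor_S_intro (n : nat) (g g1 : C -> C) (z0 a : C) :
  near z0 (fun z => g z = (a + (z - z0) * g1 z)%C) ->
  taylor n g1 z0 -> taylor (S n) g z0.
Proof.
  intros H Ht. exists g1. split; [|exact Ht].
  pose proof (near_at _ _ H) as H0. simpl in H0.
  apply near_imp with (2 := H). intros z ->. rewrite H0. ring.
Qed.

Lemma taylor_ext (n : nat) (g h : C -> C) (z0 : C) :
  near z0 (fun z => h z = g z) -> taylor n g z0 -> taylor n h z0.
Proof.
  intros H. destruct n as [|n].
  - intros [B HB]. exists B.
    apply near_imp with (2 := near_and _ _ _ H HB). intros z [-> Hz]. exact Hz.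
  - intros [g1 [Hg1 Ht]]. apply taylor_S_intro with g1 (g z0); [|exact Ht].
    apply near_imp with (2 := near_and _ _ _ H Hg1). intros z [-> Hz]. exact Hz.
Qed.

Lemma taylor_weaken (n : nat) (g : C -> C) (z0 : C) :
  taylor (S n) g z0 -> taylor n g z0.
Proof.
  revert g. induction n as [|n IH]; intros g [g1 [Hg1 Ht]].
  - destruct Ht as [B HB]. exists (Cmod (g z0) + 1 * B).
    assert (H1 : near z0 (fun z => Cmod (z - z0) < 1)).
    { apply (near_intro _ _ 1); [lra|]. auto. }
    apply near_imp with (2 := near_and _ _ _ H1 (near_and _ _ _ Hg1 HB)).
    intros z (Hz & -> & Hb). eapply Rle_trans; [apply Cmod_triangle|].
    rewrite Cmod_mult. apply Rplus_le_compat_l, Rmult_le_compat; try apply Cmod_ge_0; lra.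
  - exists g1. split; [exact Hg1|]. apply IH, Ht.
Qed.

Lemma taylor_le (m n : nat) (g : C -> C) (z0 : C) :
  (m <= n)%nat -> taylor n g z0 -> taylor m g z0.
Proof. induction 1; auto using taylor_weaken. Qed.

Lemma taylor_const (n : nat) (c z0 : C) : taylor n (fun _ => c) z0.
Proof.
  revert c. induction n as [|n IH]; intros c.
  - exists (Cmod c). apply near_all. intros; lra.
  - apply taylor_S_intro with (fun _ => 0%C) c; [|apply IH].
    apply near_all. intros; ring.
Qed.

Lemma taylor_id (n : nat) (z0 : C) : taylor n (fun z => z) z0.
Proof.
  apply taylor_weaken, taylor_S_intro with (fun _ => 1%C) z0; [|apply taylor_const].
  apply near_all. intros; ring.
Qed.

Lemma taylor_plus (n : nat) (g h : C -> C) (z0 : C) :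
  taylor n g z0 -> taylor n h z0 -> taylor n (fun z => g z + h z)%C z0.
Proof.
  revert g h. induction n as [|n IH]; intros g h.
  - intros [B HB] [B' HB']. exists (B + B').
    apply near_imp with (2 := near_and _ _ _ HB HB'). intros z [H H'].
    eapply Rle_trans; [apply Cmod_triangle|lra].
  - intros [g1 [Hg Tg]] [h1 [Hh Th]].
    apply taylor_S_intro with (fun z => g1 z + h1 z)%C (g z0 + h z0)%C; [|auto].
    apply near_imp with (2 := near_and _ _ _ Hg Hh). intros z [-> ->]. ring.
Qed.

Lemma taylor_mult (n : nat) (g h : C -> C) (z0 : C) :
  taylor n g z0 -> taylor n h z0 -> taylor n (fun z => g z * h z)%C z0.
Proof.
  revert g h. induction n as [|n IH]; intros g h Tg Th.
  - destruct Tg as [B HB], Th as [B' HB']. exists (B * B').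
    apply near_imp with (2 := near_and _ _ _ HB HB'). intros z [H H'].
    rewrite Cmod_mult. apply Rmult_le_compat; try apply Cmod_ge_0; assumption.
  - pose proof (taylor_weaken _ _ _ Th) as Th'.
    destruct Tg as [g1 [Hg Tg]], Th as [h1 [Hh Th]].
    apply taylor_S_intro with (fun z => g1 z * h z + g z0 * h1 z)%C (g z0 * h z0)%C.
    + apply near_imp with (2 := near_and _ _ _ Hg Hh). intros z [-> Hz].
      rewrite Hz. ring.
    + apply taylor_plus; apply IH; auto using taylor_const.
Qed.

Lemma taylor_continuous (g : C -> C) (z0 : C) (eps : R) :
  taylor 1 g z0 -> 0 < eps -> near z0 (fun z => Cmod (g z - g z0) < eps).
Proof.
  intros [g1 [Hg [B HB]]] Heps.
  assert (HB0 : 0 <= B).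
  { apply Rle_trans with (2 := near_at _ _ HB). apply Cmod_ge_0. }
  assert (H1 : near z0 (fun z => Cmod (z - z0) < eps / (B + 1))).
  { apply near_intro with (eps / (B + 1)); [|auto]. apply Rdiv_lt_0_compat; lra. }
  apply near_imp with (2 := near_and _ _ _ H1 (near_and _ _ _ Hg HB)).
  intros z (Hz & -> & Hb).
  replace (g z0 + (z - z0) * g1 z - g z0)%C with ((z - z0) * g1 z)%C by ring.
  rewrite Cmod_mult.
  apply Rle_lt_trans with (Cmod (z - z0) * (B + 1)).
  - apply Rmult_le_compat_l; [apply Cmod_ge_0|lra].
  - apply Rmult_lt_compat_r with (r := B + 1) in Hz; [|lra].
    replace (eps / (B + 1) * (B + 1)) with eps in Hz by (field; lra). exact Hz.
Qed.

Lemma taylor_near_neq_0 (g : C -> C) (z0 : C) :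
  taylor 1 g z0 -> g z0 <> 0%C -> near z0 (fun z => Cmod (g z0) / 2 < Cmod (g z)).
Proof.
  intros H H0. apply Cmod_gt_0 in H0.
  apply near_imp with (2 := taylor_continuous _ _ (Cmod (g z0) / 2) H ltac:(lra)).
  intros z Hz. pose proof (Cmod_triangle_minus (g z0) (g z)).
  rewrite Cmod_minus_sym in Hz. lra.
Qed.

(** The divided difference of 1/g is - g1 / (g(z0) g), in which 1/g occurs at
    one order less; continuity of g bounds 1/g to start the induction. *)
Lemma taylor_inv (n : nat) (g : C -> C) (z0 : C) :
  taylor (S n) g z0 -> g z0 <> 0%C -> taylor (S n) (fun z => / g z)%C z0.
Proof.
  intros T H0.
  assert (T1 : taylor 1 g z0) by (apply taylor_le with (2 := T); auto with arith).
  pose proof (taylor_near_neq_0 _ _ T1 H0) as Hn.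
  assert (Hp : 0 < Cmod (g z0)) by (apply Cmod_gt_0; exact H0).
  assert (Hstep : forall m, taylor (S m) g z0 -> taylor m (fun z => / g z)%C z0 ->
    taylor (S m) (fun z => / g z)%C z0).
  { intros m [g1 [Hg Tg]] Ti.
    apply taylor_S_intro with (fun z => - / g z0 * (g1 z * / g z))%C (/ g z0)%C.
    - apply near_imp with (2 := near_and _ _ _ Hg Hn). intros z [Hz Hm].
      assert (Hz0 : g z <> 0%C) by (apply Cmod_gt_0; lra).
      replace ((z - z0) * (- / g z0 * (g1 z * / g z)))%C
        with (- / g z0 * / g z * ((z - z0) * g1 z))%C by ring.
      replace ((z - z0) * g1 z)%C with (g z - g z0)%C by (rewrite Hz; ring).
      field. split; assumption.
    - apply taylor_mult; [apply taylor_const|]. apply taylor_mult; assumption. }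
  revert T. induction n as [|n IH]; intros T; apply Hstep; auto.
  - exists (/ (Cmod (g z0) / 2)). apply near_imp with (2 := Hn). intros z Hz.
    rewrite Cmod_inv by (apply Cmod_gt_0; lra).
    apply Rinv_le_contravar; lra.
  - apply IH, taylor_weaken, T.
Qed.

(** The extra order on the inner function supplies its continuity when n = 0. *)
Lemma taylor_comp (n : nat) (h g : C -> C) (z0 : C) :
  taylor n h (g z0) -> taylor (S n) g z0 -> taylor n (fun z => h (g z)) z0.
Proof.
  intros Th Tg.
  assert (Hpull : forall P, near (g z0) P -> near z0 (fun z => P (g z))).
  { intros P HP. destruct (near_elim _ _ HP) as [d [Hd HP']].
    assert (T1 : taylor 1 g z0) by (apply taylor_le with (2 := Tg); auto with arith).
    apply near_imp with (2 := taylor_continuous _ _ d T1 Hd). auto. }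
  revert h Th Tg. induction n as [|n IH]; intros h Th Tg.
  - destruct Th as [B HB]. exists B. apply (Hpull _ HB).
  - pose proof (taylor_weaken _ _ _ Tg) as Tg'.
    destruct Th as [h1 [Hh Th]], Tg as [g1 [Hg Tg]].
    apply taylor_S_intro with (fun z => g1 z * h1 (g z))%C (h (g z0)).
    + apply near_imp with (2 := near_and _ _ _ Hg (Hpull _ Hh)).
      intros z [Hz ->]. replace (g z - g z0)%C with ((z - z0) * g1 z)%C by (rewrite Hz; ring).
      ring.
    + apply taylor_mult; [apply taylor_weaken, Tg|]. apply IH; assumption.
Qed.

(** Links the derivative, which is a limit of quotients, with expansions:
    every differentiation rule below is read off a divided difference. *)
Lemma C_derive_taylor (g g1 : C -> C) (z0 : C) :
  near z0 (fun z => g z = (g z0 + (z - z0) * g1 z)%C) -> taylor 1 g1 z0 ->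
  C_derive g z0 = g1 z0.
Proof.
  intros Hg T. unfold C_derive. apply is_C_lim_unique.
  intros P [eps HP].
  pose proof (taylor_continuous _ _ eps T (cond_pos eps)) as Hc.
  unfold filtermap, locally', within. apply locally_C.
  apply filter_imp with (2 := near_and _ _ _ Hg Hc).
  intros z [Hz Hb] Hne.
  apply HP. apply C_NormedModule_mixin_compat1.
  rewrite Hz.
  replace ((g z0 + (z - z0) * g1 z - g z0) / (z - z0))%C with (g1 z); [exact Hb|].
  field. apply Cminus_neq_0, Hne.
Qed.

Lemma taylor_derive (n : nat) (g : C -> C) (z0 : C) :
  taylor (S (S n)) g z0 -> exists g1,
    near z0 (fun z => g z = (g z0 + (z - z0) * g1 z)%C) /\
    taylor (S n) g1 z0 /\ g1 z0 = C_derive g z0.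
Proof.
  intros [g1 [Hg T]]. exists g1. split; [exact Hg|split; [exact T|]].
  symmetry. apply C_derive_taylor; [exact Hg|].
  apply taylor_le with (2 := T). auto with arith.
Qed.

Lemma C_derive_ext (g h : C -> C) (z0 : C) :
  near z0 (fun z => h z = g z) -> taylor 2 g z0 -> C_derive h z0 = C_derive g z0.
Proof.
  intros H T. destruct (taylor_derive _ _ _ T) as [g1 [Hg [Tg <-]]].
  apply C_derive_taylor; [|exact Tg].
  pose proof (near_at _ _ H) as H0. simpl in H0. rewrite H0.
  apply near_imp with (2 := near_and _ _ _ H Hg). intros z [-> Hz]. exact Hz.
Qed.

Lemma C_derive_mult (g h : C -> C) (z0 : C) :
  taylor 2 g z0 -> taylor 2 h z0 ->
  C_derive (fun z => g z * h z)%C z0 =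
    (C_derive g z0 * h z0 + g z0 * C_derive h z0)%C.
Proof.
  intros Tg Th. pose proof (taylor_weaken _ _ _ Th) as Th'.
  destruct (taylor_derive _ _ _ Tg) as [g1 [Hg [Tg1 <-]]].
  destruct (taylor_derive _ _ _ Th) as [h1 [Hh [Th1 <-]]].
  rewrite (C_derive_taylor _ (fun z => g1 z * h z + g z0 * h1 z)%C); [reflexivity| |].
  - apply near_imp with (2 := near_and _ _ _ Hg Hh). intros z [-> Hz]. rewrite Hz. ring.
  - apply taylor_plus; apply taylor_mult; auto using taylor_const.
Qed.

Lemma C_derive_comp (h g : C -> C) (z0 : C) :
  taylor 2 h (g z0) -> taylor 2 g z0 ->
  C_derive (fun z => h (g z)) z0 = (C_derive g z0 * C_derive h (g z0))%C.
Proof.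
  intros Th Tg.
  destruct (taylor_derive _ _ _ Th) as [h1 [Hh [Th1 <-]]].
  pose proof (taylor_comp 1 h1 g z0 Th1 Tg) as Tc.
  pose proof (taylor_weaken _ _ _ Tg) as Tg'.
  destruct (taylor_derive _ _ _ Tg) as [g1 [Hg [Tg1 <-]]].
  rewrite (C_derive_taylor _ (fun z => g1 z * h1 (g z))%C); [reflexivity| |].
  - destruct (near_elim _ _ Hh) as [d [Hd Hh']].
    apply near_imp with (2 := near_and _ _ _ Hg (taylor_continuous _ _ d Tg' Hd)).
    intros z [Hz Hb]. rewrite (Hh' _ Hb).
    replace (g z - g z0)%C with ((z - z0) * g1 z)%C by (rewrite Hz; ring). ring.
  - apply taylor_mult; assumption.
Qed.

Lemma C_derive_id (z0 : C) : C_derive (fun z => z) z0 = 1%C.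
Proof.
  apply (C_derive_taylor _ (fun _ => 1%C)); [|apply taylor_const].
  apply near_all. intros; ring.
Qed.

Lemma C_derive_const (c z0 : C) : C_derive (fun _ => c) z0 = 0%C.
Proof.
  apply (C_derive_taylor _ (fun _ => 0%C)); [|apply taylor_const].
  apply near_all. intros; ring.
Qed.

(** The divided difference with its removable singularity filled in. *)
Definition slope (g : C -> C) (a z : C) : C :=
  if Ceq_dec z a then C_derive g a else ((g z - g a) / (z - a))%C.

Lemma slope_at (g : C -> C) (a : C) : slope g a a = C_derive g a.
Proof. unfold slope. destruct (Ceq_dec a a); [reflexivity|congruence]. Qed.

Lemma slope_spec (g : C -> C) (a z : C) : g z = (g a + (z - a) * slope g a z)%C.
Proof.
  unfold slope. destruct (Ceq_dec z a) as [->|H]; [ring|].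
  field. apply Cminus_neq_0, H.
Qed.

Lemma slope_neq (g : C -> C) (a z : C) :
  z <> a -> slope g a z = ((g z - g a) / (z - a))%C.
Proof. intros H. unfold slope. destruct (Ceq_dec z a); congruence. Qed.

(** Dividing by z - a costs one order at a, and none elsewhere
    ([taylor_slope]). *)
Lemma taylor_slope_at (n : nat) (g : C -> C) (a : C) :
  taylor (S (S n)) g a -> taylor (S n) (slope g a) a.
Proof.
  intros T. destruct (taylor_derive _ _ _ T) as [g1 [Hg [Tg Hd]]].
  apply taylor_ext with (2 := Tg). apply near_imp with (2 := Hg). intros z Hz.
  unfold slope. destruct (Ceq_dec z a) as [->|H]; [auto|].
  rewrite Hz. field. apply Cminus_neq_0, H.
Qed.

Lemma taylor_slope (n : nat) (g : C -> C) (a z0 : C) :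
  taylor (S (S n)) g a -> taylor (S n) g z0 -> taylor (S n) (slope g a) z0.
Proof.
  intros Ta T. destruct (Ceq_dec z0 a) as [->|H]; [apply taylor_slope_at, Ta|].
  apply taylor_ext with (fun z => (g z + - g a) * / (z + - a))%C.
  - apply near_imp with (2 := near_neq _ _ H). intros z Hz. apply slope_neq, Hz.
  - apply taylor_mult.
    + apply taylor_plus; [exact T|apply taylor_const].
    + apply taylor_inv.
      * apply taylor_plus; [apply taylor_id|apply taylor_const].
      * apply Cminus_neq_0, H.
Qed.

(** * Taylor expansions of power series *)

Lemma pow_n_Cpow (z : C) (n : nat) : @pow_n C_Ring z n = Cpow z n.
Proof. induction n as [|n IH]; [reflexivity|]. simpl. rewrite IH. reflexivity. Qed.

(** Convergence at distance r/2 bounds the terms there by 2 M, so at distance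
    below r/4 the series is dominated by a geometric one of ratio 1/2. *)
Lemma analytic_bounded (f : C -> C) (z0 : C) : analytic_at f z0 -> taylor 0 f z0.
Proof.
  intros (a & r & Hr & Hf).
  set (u := fun (h : C) (k : nat) => @scal C_AbsRing C_NormedModule (@pow_n C_AbsRing h k) (a k) : C).
  assert (Hu : forall h k, Cmod (u h k) = Cmod h ^ k * Cmod (a k)).
  { intros h k. unfold u. change (Cmod (@pow_n C_Ring h k * a k)%C = Cmod h ^ k * Cmod (a k)).
    rewrite pow_n_Cpow, Cmod_mult, Cmod_pow. reflexivity. }
  set (w := RtoC (r / 2)).
  assert (Hw : Cmod w = r / 2).
  { unfold w. rewrite Cmod_R. apply Rabs_pos_eq. lra. }
  assert (Hs : @is_pseries C_AbsRing C_NormedModule a w (f (z0 + w)%C)).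
  { replace w with (z0 + w - z0)%C at 1 by ring. apply Hf.
    replace (z0 + w - z0)%C with w by ring. lra. }
  destruct (@filterlim_bounded C_AbsRing C_NormedModule (sum_n (u w))
    (ex_intro _ _ Hs)) as [M HM].
  assert (HMC : forall n, Cmod (sum_n (u w) n) <= M) by (intros n; exact (HM n)).
  assert (HM0 : 0 <= M) by (eapply Rle_trans; [apply Cmod_ge_0|apply (HMC 0%nat)]).
  assert (Hterm : forall k, Cmod (u w k) <= 2 * M).
  { intros [|k].
    - specialize (HMC 0%nat). rewrite sum_O in HMC. lra.
    - pose proof (HMC k) as H1. pose proof (HMC (S k)) as H2.
      rewrite sum_Sn in H2. set (s := sum_n (u w) k : C) in *.
      change (Cmod (s + u w (S k))%C <= M) in H2.
      pose proof (Cmod_triangle (s + u w (S k)) (- s)) as H3.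
      rewrite Cmod_opp in H3.
      replace (s + u w (S k) + - s)%C with (u w (S k)) in H3 by ring.
      lra. }
  exists (4 * M + 1). apply near_intro with (r / 4); [lra|]. intros z Hz.
  specialize (Hf z ltac:(lra)).
  set (h := (z - z0)%C) in *.
  assert (Hh : forall k, Cmod (u h k) <= 2 * M * (1 / 2) ^ k).
  { intros k. rewrite Hu. specialize (Hterm k). rewrite Hu, Hw in Hterm.
    apply Rle_trans with ((r / 2 * (1 / 2)) ^ k * Cmod (a k)).
    - apply Rmult_le_compat_r; [apply Cmod_ge_0|]. apply pow_incr.
      split; [apply Cmod_ge_0|lra].
    - rewrite Rpow_mult_distr. pose proof (pow_lt (1 / 2) k ltac:(lra)). nra. }
  assert (Hsum : forall n, Cmod (sum_n (u h) n) <= 2 * M * (2 - (1 / 2) ^ n)).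
  { induction n as [|n IH].
    - rewrite sum_O. specialize (Hh 0%nat). simpl in *. lra.
    - rewrite sum_Sn. eapply Rle_trans; [apply Cmod_triangle|].
      specialize (Hh (S n)). simpl in *. lra. }
  pose proof (proj1 (filterlim_locally_ball_norm (sum_n (u h)) (f z)) Hf (mkposreal 1 Rlt_0_1))
    as [N HN].
  specialize (HN N (Nat.le_refl N)). specialize (Hsum N).
  change (Cmod (sum_n (u h) N - f z)%C < 1) in HN.
  rewrite Cmod_minus_sym in HN.
  pose proof (Cmod_triangle_minus (f z) (sum_n (u h) N)) as Ht.
  pose proof (pow_lt (1 / 2) N ltac:(lra)).
  apply Rle_trans with (Cmod (sum_n (u h) N) + 1); [lra|]. 
  assert (2 * M * (2 - (1/2)^N) <= 4 * M) by nra. lra.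
Qed.

(** Shifting the coefficients gives a power series for the divided difference,
    so boundedness of power series is enough. *)
Lemma taylor_analytic (n : nat) (f : C -> C) (z0 : C) :
  analytic_at f z0 -> taylor n f z0.
Proof.
  revert f. induction n as [|n IH]; intros f Hf; [apply analytic_bounded, Hf|].
  destruct Hf as (a & r & Hr & Hf).
  set (g := fun z => if Ceq_dec z z0 then a 1%nat else ((f z - a 0%nat) / (z - z0))%C).
  assert (Hg : forall z, Cmod (z - z0) < r -> f z = (a 0%nat + (z - z0) * g z)%C).
  { intros z Hz. unfold g. destruct (Ceq_dec z z0) as [->|H].
    - specialize (Hf z0 Hz).
      assert (E0 : (z0 - z0 = 0)%C) by ring. rewrite E0 in Hf |- *.
      pose proof (@is_pseries_0 C_AbsRing C_NormedModule a) as H0.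
      pose proof (@filterlim_locally_unique nat C_AbsRing C_NormedModule eventually _ _ _ _ Hf H0) as E. simpl in E. rewrite E.
      ring.
    - field. apply Cminus_neq_0, H. }
  apply taylor_S_intro with g (a 0%nat).
  - apply near_intro with r; assumption.
  - apply IH. exists (PS_decr_1 a), r. split; [exact Hr|]. intros z Hz.
    unfold g. destruct (Ceq_dec z z0) as [->|H].
    + assert (E0 : (z0 - z0 = 0)%C) by ring. rewrite E0.
      exact (@is_pseries_0 C_AbsRing C_NormedModule (PS_decr_1 a)).
    + pose proof (@is_pseries_decr_1 C_AbsRing C_NormedModule a (z - z0)%C (/ (z - z0))%C (f z)) as Hd.
      replace ((f z - a 0%nat) / (z - z0))%C with (@scal C_AbsRing C_NormedModule (/ (z - z0))%C (plus (f z) (opp (a 0%nat)))).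
      * apply Hd; [|apply Hf, Hz]. apply Cinv_l, Cminus_neq_0, H.
      * change (/ (z - z0) * (f z + - a 0%nat) = (f z - a 0%nat) / (z - z0))%C. 
        unfold Cdiv. ring.
Qed.

(** * The maximum modulus principle *)

(** The radius of the neighbourhood chosen at z is taken below the inverse of
    the local bound; the positive lower bound d on the radii of a finite
    subcover then bounds v by 1/d. *)
Lemma disk_locally_bounded (v : C -> R) (rho : R) :
  (forall z, Cmod z <= rho ->
     exists B, near z (fun w => Cmod w <= rho -> v w <= B)) ->
  exists M, forall z, Cmod z <= rho -> v z <= M.
Proof.
  intros Hloc.
  (* [compactness_value_2d] uses squares; one of half-side d lies in the disk of
     radius sqrt 2 * d *)
  assert (Hdelta : forall z : C, exists d : posreal, forall w : C,
    Cmod (w - z) < sqrt 2 * d -> Cmod w <= rho -> v w <= / d).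
  { intros z.
    assert (Hs : 0 < sqrt 2) by (apply sqrt_lt_R0; lra).
    assert (HB : exists B, 0 < B /\ near z (fun w => Cmod w <= rho -> v w <= B)).
    { destruct (Rle_lt_dec (Cmod z) rho) as [Hz|Hz].
      - destruct (Hloc z Hz) as [B HB]. exists (Rmax B 1).
        split; [apply Rlt_le_trans with (2 := Rmax_r _ _); lra|].
        apply near_imp with (2 := HB). intros w Hw Hr.
        apply Rle_trans with (2 := Rmax_l _ _). auto.
      - exists 1. split; [lra|]. apply near_intro with (Cmod z - rho); [lra|].
        intros w Hw Hr. rewrite Cmod_minus_sym in Hw.
        pose proof (Cmod_triangle_minus z w). lra. }
    destruct HB as (B & HB0 & HB). destruct (near_elim _ _ HB) as (d & Hd & Hw).
    assert (Hm : 0 < Rmin (d / sqrt 2) (/ B)).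
    { apply Rmin_pos; [apply Rdiv_lt_0_compat; assumption|apply Rinv_0_lt_compat, HB0]. }
    exists (mkposreal _ Hm). intros w Hlt Hr. simpl in *.
    apply Rle_trans with B.
    - apply Hw; [|exact Hr]. apply Rlt_le_trans with (1 := Hlt).
      replace d with (sqrt 2 * (d / sqrt 2)) at 2 by (field; lra).
      apply Rmult_le_compat_l; [lra|]. apply Rmin_l.
    - rewrite <- (Rinv_inv B) at 1. apply Rinv_le_contravar; [exact Hm|apply Rmin_r]. }
  destruct (functional_choice _ Hdelta) as [delta Hd]. clear Hdelta.
  destruct (compactness_value_2d (- rho) rho (- rho) rho (fun x y => delta (x, y))) as [d Hc].
  exists (/ d). intros [x y] Hz.
  pose proof (Rmax_Cmod (x, y)) as Hxy. simpl in Hxy.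
  pose proof (Rmax_l (Rabs x) (Rabs y)). pose proof (Rmax_r (Rabs x) (Rabs y)).
  assert (Hx : - rho <= x <= rho) by (apply Rabs_le_between; lra).
  assert (Hy : - rho <= y <= rho) by (apply Rabs_le_between; lra).
  apply Rnot_lt_le. intros Hlt. apply (Hc x y Hx Hy).
  intros (s & t & _ & _ & Hs & Ht & Hdd).
  apply Rlt_not_le with (1 := Hlt).
  apply Rle_trans with (/ delta (s, t)).
  - apply Hd; [|exact Hz].
    eapply Rle_lt_trans; [apply Cmod_2Rmax|].
    apply Rmult_lt_compat_l; [apply sqrt_lt_R0; lra|].
    apply Rmax_lub_lt; assumption.
  - apply Rinv_le_contravar; [apply cond_pos|exact Hdd].
Qed.

(** If the supremum S were not attained, 1 / (S - u) would be locally bounded,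
    hence bounded, and S could be lowered. *)
Lemma disk_attains_max (u : C -> R) (rho : R) :
  0 <= rho ->
  (forall z eps, Cmod z <= rho -> 0 < eps -> near z (fun w => u w < u z + eps)) ->
  exists z, Cmod z <= rho /\ forall w, Cmod w <= rho -> u w <= u z.
Proof.
  intros Hrho Hu. apply NNPP. intros Hno.
  destruct (disk_locally_bounded u rho) as [M HM].
  { intros z Hz. exists (u z + 1).
    apply near_imp with (2 := Hu z 1 Hz ltac:(lra)). intros w Hw _. lra. }
  destruct (completeness (fun y => exists z, Cmod z <= rho /\ y = u z)) as [S [HS1 HS2]].
  { exists M. intros y (z & Hz & ->). auto. }
  { exists (u 0%C), 0%C. rewrite Cmod_0. auto. }
  assert (Hlt : forall z, Cmod z <= rho -> u z < S).
  { intros z Hz. destruct (Rlt_le_dec (u z) S) as [H|H]; [exact H|].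
    exfalso. apply Hno. exists z. split; [exact Hz|]. intros w Hw.
    apply Rle_trans with (2 := H). apply HS1. exists w. auto. }
  destruct (disk_locally_bounded (fun z => / (S - u z)) rho) as [N HN].
  { intros z Hz. pose proof (Hlt z Hz) as Hz'.
    exists (/ ((S - u z) / 2)).
    apply near_imp with (2 := Hu z ((S - u z) / 2) Hz ltac:(lra)).
    intros w Hw Hr. apply Rinv_le_contravar; lra. }
  assert (HN0 : 0 < N).
  { specialize (HN 0%C). rewrite Cmod_0 in HN. apply Rlt_le_trans with (2 := HN Hrho).
    apply Rinv_0_lt_compat. specialize (Hlt 0%C). rewrite Cmod_0 in Hlt.
    specialize (Hlt Hrho). lra. }
  assert (S <= S - / N); [|pose proof (Rinv_0_lt_compat N HN0); lra].
  apply HS2. intros y (z & Hz & ->).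
  specialize (HN z Hz). specialize (Hlt z Hz).
  assert (/ N <= S - u z); [|lra].
  rewrite <- (Rinv_inv (S - u z)). apply Rinv_le_contravar; [|exact HN].
  apply Rinv_0_lt_compat. lra.
Qed.

Lemma Cmod_sqr_sub (z w : C) :
  Cmod z ^ 2 - 2 * Cmod z * Cmod w <= Cmod (z + w) ^ 2.
Proof.
  pose proof (Cmod_triangle_minus z (- w)) as H. rewrite Cmod_opp in H.
  replace (z - - w)%C with (z + w)%C in H by ring.
  pose proof (Cmod_ge_0 z). pose proof (Cmod_ge_0 w). pose proof (Cmod_ge_0 (z + w)).
  destruct (Rle_lt_dec (Cmod z) (Cmod w)); nra.
Qed.

(** Sum over the four points z0 + h with h = d, -d, id, -id.  The terms in h, in
    h^2 and in the mixed products cancel, so |g|^2 contributes at least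
    4 |g(z0)|^2 up to O(d^3), while eps |z|^2 contributes an extra 4 eps d^2. *)
Lemma no_local_max (g : C -> C) (z0 : C) (eps d0 : R) :
  taylor 3 g z0 -> 0 < eps -> 0 < d0 ->
  exists z, Cmod (z - z0) < d0 /\
    Cmod (g z0) ^ 2 + eps * Cmod z0 ^ 2 < Cmod (g z) ^ 2 + eps * Cmod z ^ 2.
Proof.
  intros (g1 & H1 & g2 & H2 & g3 & H3 & B & HB) Heps Hd0.
  set (a0 := g z0) in *. set (a1 := g1 z0) in *. set (a2 := g2 z0) in *.
  assert (HB0 : 0 <= B) by (apply Rle_trans with (2 := near_at _ _ HB); apply Cmod_ge_0).
  destruct (near_elim _ _ (near_and _ _ _ H1 (near_and _ _ _ H2 (near_and _ _ _ H3 HB))))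
    as (d1 & Hd1 & Hg). clear H1 H2 H3 HB.
  set (P := Cmod a0 + Cmod a1 + Cmod a2).
  assert (HP : 0 <= P).
  { pose proof (Cmod_ge_0 a0). pose proof (Cmod_ge_0 a1). pose proof (Cmod_ge_0 a2).
    unfold P; lra. }
  (* small enough for the cubic remainder 2 P B d^3 to stay below eps d^2 *)
  set (d := Rmin (Rmin (d0 / 2) (d1 / 2)) (Rmin 1 (eps / (2 * P * B + 1)))).
  assert (HPB : 0 <= P * B) by (apply Rmult_le_pos; assumption).
  assert (Hd : 0 < d).
  { unfold d. repeat apply Rmin_pos; try lra. apply Rdiv_lt_0_compat; lra. }
  assert (Hdd0 : d < d0).
  { apply Rle_lt_trans with (d0 / 2); [|lra]. unfold d. eapply Rle_trans; [apply Rmin_l|apply Rmin_l]. }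
  assert (Hdd1 : d < d1).
  { apply Rle_lt_trans with (d1 / 2); [|lra]. unfold d. eapply Rle_trans; [apply Rmin_l|apply Rmin_r]. }
  assert (Hd_1 : d <= 1).
  { unfold d. eapply Rle_trans; [apply Rmin_r|apply Rmin_l]. }
  assert (Hde : 2 * P * B * d < eps).
  { assert (H : d <= eps / (2 * P * B + 1)) by (unfold d; eapply Rle_trans; [apply Rmin_r|apply Rmin_r]).
    apply Rmult_le_compat_r with (r := 2 * P * B + 1) in H; [|lra].
    replace (eps / (2 * P * B + 1) * (2 * P * B + 1)) with eps in H by (field; lra). lra. }
  clearbody d.
  apply NNPP. intros Hno.
  assert (Hle : forall h : C, Cmod h = d ->
    Cmod (a0 + h * (a1 + h * a2)) ^ 2 - 2 * P * B * d ^ 3 + eps * Cmod (z0 + h) ^ 2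
      <= Cmod a0 ^ 2 + eps * Cmod z0 ^ 2).
  { intros h Hh. apply Rnot_lt_le. intros Hlt. apply Hno. exists (z0 + h)%C.
    assert (E : (z0 + h - z0 = h)%C) by ring.
    rewrite E, Hh. split; [exact Hdd0|]. apply Rlt_le_trans with (1 := Hlt).
    apply Rplus_le_compat_r.
    destruct (Hg (z0 + h)%C) as (-> & -> & -> & Hb); [rewrite E, Hh; exact Hdd1|].
    rewrite E. set (b := g3 (z0 + h)%C) in *.
    replace (a0 + h * (a1 + h * (a2 + h * b)))%C
      with ((a0 + h * (a1 + h * a2)) + (h * h * h * b))%C by ring.
    eapply Rle_trans; [|apply Cmod_sqr_sub].
    assert (Hp : Cmod (a0 + h * (a1 + h * a2)) <= P).
    { eapply Rle_trans; [apply Cmod_triangle|]. rewrite Cmod_mult, Hh.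
      assert (Cmod (a1 + h * a2) <= Cmod a1 + Cmod a2).
      { eapply Rle_trans; [apply Cmod_triangle|]. rewrite Cmod_mult, Hh.
        pose proof (Cmod_ge_0 a2). nra. }
      pose proof (Cmod_ge_0 (a1 + h * a2)). unfold P. nra. }
    rewrite !Cmod_mult, Hh.
    pose proof (Cmod_ge_0 (a0 + h * (a1 + h * a2))) as Hp0.
    pose proof (Cmod_ge_0 b) as Hb0.
    assert (Cmod (a0 + h * (a1 + h * a2)) * Cmod b <= P * B) by (apply Rmult_le_compat; assumption).
    assert (0 < d ^ 3) by (apply pow_lt; exact Hd). simpl in *. nra. }
  assert (Hm : forall x y, x ^ 2 + y ^ 2 = d ^ 2 -> Cmod (x, y) = d).
  { intros x y Hxy. unfold Cmod. simpl fst; simpl snd. rewrite Hxy. apply sqrt_pow2. lra. }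
  pose proof (Hle (d, 0) (Hm d 0 ltac:(ring))) as Q1.
  pose proof (Hle (- d, 0) (Hm (- d) 0 ltac:(ring))) as Q2.
  pose proof (Hle (0, d) (Hm 0 d ltac:(ring))) as Q3.
  pose proof (Hle (0, - d) (Hm 0 (- d) ltac:(ring))) as Q4.
  clearbody a0 a1 a2.
  rewrite !Cmod2_alt in Q1, Q2, Q3, Q4.
  destruct a0 as [x0 y0], a1 as [x1 y1], a2 as [x2 y2], z0 as [x y].
  unfold Re, Im in *. simpl fst in *; simpl snd in *.
  assert (Hd2 : 0 < d ^ 2) by (apply pow_lt; exact Hd).
  assert (S : 4 * eps * d ^ 2 + 4 * (x1 ^ 2 + y1 ^ 2) * d ^ 2 + 4 * (x2 ^ 2 + y2 ^ 2) * d ^ 4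
    - 8 * P * B * d ^ 3 <= 0).
  { clear - Q1 Q2 Q3 Q4. nra. }
  assert (0 <= (x1 ^ 2 + y1 ^ 2) * d ^ 2).
  { apply Rmult_le_pos; [|lra]. apply Rplus_le_le_0_compat; apply pow2_ge_0. }
  assert (0 <= (x2 ^ 2 + y2 ^ 2) * d ^ 4).
  { apply Rmult_le_pos; [apply Rplus_le_le_0_compat; apply pow2_ge_0|].
    apply pow_le. lra. }
  assert (0 < (eps - 2 * P * B * d) * d ^ 2) by (apply Rmult_lt_0_compat; lra).
  lra.
Qed.

Lemma near_Cmod_sqr (g : C -> C) (z : C) (eps : R) :
  taylor 1 g z -> 0 < eps -> near z (fun w => Cmod (g w) ^ 2 < Cmod (g z) ^ 2 + eps).
Proof.
  intros T Heps.
  pose proof (Cmod_ge_0 (g z)) as H0.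
  set (e := Rmin 1 (eps / (2 * Cmod (g z) + 2))).
  assert (He : 0 < e) by (apply Rmin_pos; [lra|apply Rdiv_lt_0_compat; lra]).
  assert (He1 : e <= 1) by apply Rmin_l.
  assert (He2 : e * (2 * Cmod (g z) + 2) <= eps).
  { assert (H : e <= eps / (2 * Cmod (g z) + 2)) by apply Rmin_r.
    apply Rmult_le_compat_r with (r := 2 * Cmod (g z) + 2) in H; [|lra].
    replace (eps / (2 * Cmod (g z) + 2) * (2 * Cmod (g z) + 2)) with eps in H by (field; lra).
    exact H. }
  apply near_imp with (2 := taylor_continuous _ _ e T He). intros w Hw.
  pose proof (Cmod_triangle_minus (g w) (g z)). pose proof (Cmod_ge_0 (g w)).
  assert (Cmod (g w) ^ 2 < (Cmod (g z) + e) ^ 2) by nra. nra.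
Qed.

(** By [no_local_max] the perturbed function |g|^2 + eps |z|^2 is maximal on the
    boundary circle; then eps tends to 0. *)
Lemma max_modulus (g : C -> C) (rho M : R) :
  (forall z, Cmod z <= rho -> taylor 3 g z) ->
  (forall z, Cmod z = rho -> Cmod (g z) <= M) ->
  forall z, Cmod z <= rho -> Cmod (g z) <= M.
Proof.
  intros T Hb z Hz.
  assert (Hrho : 0 <= rho) by (eapply Rle_trans; [apply Cmod_ge_0|exact Hz]).
  assert (HM : 0 <= M).
  { eapply Rle_trans; [apply Cmod_ge_0|apply (Hb rho)].
    rewrite Cmod_R. apply Rabs_pos_eq, Hrho. }
  assert (Heps : forall eps, 0 < eps -> Cmod (g z) ^ 2 <= M ^ 2 + eps * rho ^ 2).
  { intros eps Heps.
    destruct (disk_attains_max (fun w => Cmod (g w) ^ 2 + eps * Cmod w ^ 2) rho Hrho)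
      as (z1 & Hz1 & Hmax).
    { intros w e Hw He.
      assert (He' : 0 < e / 2 / eps) by (apply Rdiv_lt_0_compat; lra).
      apply near_imp with (2 := near_and _ _ _
        (near_Cmod_sqr g w (e / 2) (taylor_le 1 3 _ _ ltac:(auto with arith) (T w Hw)) ltac:(lra))
        (near_Cmod_sqr (fun z => z) w (e / 2 / eps) (taylor_id 1 w) He')).
      intros v [H1 H2]. apply Rmult_lt_compat_l with (r := eps) in H2; [|exact Heps].
      replace (eps * (Cmod w ^ 2 + e / 2 / eps)) with (eps * Cmod w ^ 2 + e / 2) in H2
        by (field; lra).
      lra. }
    destruct (Rle_lt_or_eq_dec _ _ Hz1) as [Hlt|Heq].
    - exfalso. destruct (no_local_max g z1 eps (rho - Cmod z1) (T z1 Hz1) Heps ltac:(lra))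
        as (w & Hw & Hgt).
      pose proof (Cmod_triangle_minus w z1). specialize (Hmax w ltac:(lra)). lra.
    - specialize (Hmax z Hz). simpl in Hmax. specialize (Hb z1 Heq). rewrite Heq in Hmax.
      pose proof (Cmod_ge_0 (g z1)).
      assert (Cmod (g z1) ^ 2 <= M ^ 2) by (apply pow_incr; lra).
      assert (0 <= eps * Cmod z ^ 2) by (apply Rmult_le_pos; [lra|apply pow2_ge_0]).
      simpl in *. lra. }
  apply Rnot_lt_le. intros Hlt.
  pose proof (pow2_ge_0 rho) as Hr2.
  assert (He : 0 < (Cmod (g z) ^ 2 - M ^ 2) / (2 * (rho ^ 2 + 1))).
  { apply Rdiv_lt_0_compat; nra. }
  specialize (Heps _ He).
  assert ((Cmod (g z) ^ 2 - M ^ 2) / (2 * (rho ^ 2 + 1)) * rho ^ 2 < Cmod (g z) ^ 2 - M ^ 2).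
  { replace (Cmod (g z) ^ 2 - M ^ 2) with
      ((Cmod (g z) ^ 2 - M ^ 2) / (2 * (rho ^ 2 + 1)) * (2 * (rho ^ 2 + 1))) at 2
      by (field; lra).
    apply Rmult_lt_compat_l; [exact He|lra]. }
  lra.
Qed.

(** * Schwarz, Schwarz-Pick and Dieudonne *)

(** Estimates on circles of radius rho < 1 pass to the unit disk through this
    limit. *)
Lemma le_of_left_limit (F : R -> R) (X m : R) :
  m < 1 -> continuity_pt F 1 -> (forall rho, m < rho < 1 -> X <= F rho) -> X <= F 1.
Proof.
  intros Hm HF H. apply Rnot_lt_le. intros Hlt.
  destruct (HF (X - F 1) ltac:(lra)) as (d & Hd & Hc).
  set (rho := Rmax (1 - d / 2) ((m + 1) / 2)).
  assert (H1 : 1 - d / 2 <= rho) by apply Rmax_l.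
  assert (H2 : (m + 1) / 2 <= rho) by apply Rmax_r.
  assert (H3 : rho < 1) by (apply Rmax_lub_lt; lra).
  specialize (H rho ltac:(lra)).
  assert (Hr : Rabs (rho - 1) < d) by (apply Rabs_def1; lra).
  specialize (Hc rho). simpl in Hc. unfold R_dist in Hc.
  assert (Hc' : Rabs (F rho - F 1) < X - F 1).
  { apply Hc. split; [split; [exact I|lra]|exact Hr]. }
  apply Rabs_def2 in Hc'. lra.
Qed.

(** On the circle of radius rho the modulus of w(z) / z is at most 1 / rho. *)
Lemma schwarz (w : C -> C) :
  (forall z, unit_disk z -> taylor 4 w z) ->
  (forall z, unit_disk z -> Cmod (w z) <= 1) -> w 0%C = 0%C ->
  forall z, unit_disk z -> Cmod (slope w 0 z) <= 1.
Proof.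
  unfold unit_disk. intros T Hw H0 z Hz.
  replace 1 with (/ 1) at 1 by field.
  apply le_of_left_limit with (F := fun rho => / rho) (m := Cmod z); [exact Hz| |].
  { apply continuity_pt_inv; [apply continuity_pt_id|unfold id; lra]. }
  pose proof (Cmod_ge_0 z) as Hz0.
  intros rho Hrho. apply max_modulus with rho; [| |lra].
  - intros v Hv. apply taylor_slope; [apply T; rewrite Cmod_0; lra|].
    apply taylor_weaken, T. lra.
  - intros v Hv.
    assert (Hv0 : v <> 0%C) by (apply Cmod_gt_0; lra).
    rewrite slope_neq, H0 by exact Hv0.
    replace ((w v - 0) / (v - 0))%C with (w v / v)%C by (field; exact Hv0).
    rewrite Cmod_div, Hv by exact Hv0.
    specialize (Hw v ltac:(lra)).
    unfold Rdiv. rewrite <- (Rmult_1_l (/ rho)) at 2.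
    apply Rmult_le_compat_r; [|exact Hw]. left. apply Rinv_0_lt_compat. lra.
Qed.

(** Makes a Blaschke quotient at most 1 in the closed disk, and close to 1 near
    the unit circle. *)
Lemma blaschke_identity (a z : C) :
  Cmod (1 - Cconj a * z) ^ 2 - Cmod (z - a) ^ 2 = (1 - Cmod a ^ 2) * (1 - Cmod z ^ 2).
Proof.
  rewrite !Cmod2_alt. destruct a as [p q], z as [x y]. simpl. ring.
Qed.

Lemma blaschke_denominator (a z : C) :
  Cmod a < 1 -> Cmod z <= 1 -> (1 - Cconj a * z)%C <> 0%C.
Proof.
  intros Ha Hz. apply Cmod_gt_0.
  pose proof (Cmod_triangle_minus 1 (Cconj a * z)) as H.
  rewrite Cmod_1, Cmod_mult, Cmod_conj in H.
  pose proof (Cmod_ge_0 a). pose proof (Cmod_ge_0 z). nra.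
Qed.

(** Maximum principle for the quotient of the Blaschke factors
    (phi - b) / (1 - conj b phi) and (z - a) / (1 - conj a z), where b = phi(a):
    the value of this quotient at a is
    phi'(a) (1 - |a|^2) / (1 - |b|^2).  Strictness of |phi| < 1 keeps the
    denominator away from 0. *)
Lemma schwarz_pick_strict (phi : C -> C) (a : C) :
  (forall z, unit_disk z -> taylor 4 phi z) ->
  (forall z, unit_disk z -> Cmod (phi z) < 1) -> unit_disk a ->
  (1 - Cmod a ^ 2) * Cmod (C_derive phi a) <= 1 - Cmod (phi a) ^ 2.
Proof.
  unfold unit_disk. intros T Hphi Ha. set (b := phi a).
  pose proof (Hphi a Ha) as Hb. fold b in Hb.
  pose proof (Cmod_ge_0 a) as Ha0. pose proof (Cmod_ge_0 b) as Hb0.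
  set (g := fun z => (slope phi a z * ((1 - Cconj a * z) * / (1 - Cconj b * phi z)))%C).
  assert (Hden : forall z, Cmod z < 1 -> (1 - Cconj b * phi z)%C <> 0%C).
  { intros z Hz. apply blaschke_denominator; [exact Hb|left; auto]. }
  assert (Tg : forall z, Cmod z < 1 -> taylor 3 g z).
  { intros z Hz. unfold g. pose proof (taylor_weaken _ _ _ (T z Hz)) as T3.
    assert (Haff : forall h, taylor 3 h z -> forall c, taylor 3 (fun v => 1 - c * h v)%C z).
    { intros h Th c. apply taylor_ext with (fun v => 1 + (- c) * h v)%C.
      - apply near_all. intros; ring.
      - apply taylor_plus; [apply taylor_const|].
        apply taylor_mult; [apply taylor_const|exact Th]. }
    apply taylor_mult; [apply taylor_slope; [apply T, Ha|exact T3]|].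
    apply taylor_mult; [apply Haff, taylor_id|].
    apply (taylor_inv 2 (fun v => 1 - Cconj b * phi v)%C); [apply Haff, T3|apply Hden, Hz]. }
  assert (Hbound : Cmod (g a) ^ 2 <= 1).
  { set (F := fun rho => 1 + (1 - rho * rho) / ((rho - Cmod a) * (rho - Cmod a))).
    replace 1 with (F 1) by (unfold F; field; lra).
    apply le_of_left_limit with (m := Cmod a); [exact Ha| |]; unfold F.
    { apply derivable_continuous_pt. reg. nra. }
    intros rho Hrho.
    assert (Hq : 0 <= (1 - rho * rho) / ((rho - Cmod a) * (rho - Cmod a))).
    { apply Rdiv_le_0_compat; nra. }
    set (M := 1 + (1 - rho * rho) / ((rho - Cmod a) * (rho - Cmod a))) in *.
    assert (HM : 0 <= M) by (unfold M; lra).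
    rewrite <- (pow2_sqrt M HM). apply pow_incr. split; [apply Cmod_ge_0|].
    apply max_modulus with rho; [intros z Hz; apply Tg; lra| |lra].
    intros z Hz. rewrite <- (sqrt_pow2 (Cmod (g z)) (Cmod_ge_0 _)). apply sqrt_le_1_alt.
    assert (Hza : z <> a) by (intros ->; lra).
    assert (Hz1 : Cmod z < 1) by lra.
    unfold g. rewrite slope_neq by exact Hza.
    pose proof (Hden z Hz1) as Hd. pose proof (Cminus_neq_0 _ _ Hza) as Hd'.
    rewrite !Cmod_mult, Cmod_div, Cmod_inv by assumption.
    apply Cmod_gt_0 in Hd. apply Cmod_gt_0 in Hd'.
    pose proof (blaschke_identity b (phi z)) as I1.
    pose proof (blaschke_identity a z) as I2. rewrite Hz in I2.
    pose proof (Hphi z Hz1) as Hp. pose proof (Cmod_ge_0 (phi z)) as Hp0.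
    pose proof (Cmod_triangle_minus z a) as Htr. rewrite Hz in Htr.
    fold b. set (N := Cmod (phi z - b)) in *. set (D := Cmod (1 - Cconj b * phi z)) in *.
    set (E := Cmod (1 - Cconj a * z)) in *. set (Q := Cmod (z - a)) in *.
    assert (HND : N ^ 2 <= D ^ 2).
    { assert (0 <= (1 - Cmod b ^ 2) * (1 - Cmod (phi z) ^ 2)); [|lra].
      apply Rmult_le_pos; nra. }
    replace ((N / Q * (E * / D)) ^ 2) with ((N ^ 2 / D ^ 2) * (E ^ 2 / Q ^ 2)) by (field; split; apply Rgt_not_eq; assumption).
    assert (H1 : N ^ 2 / D ^ 2 <= 1).
    { apply Rle_div_l; [apply Rlt_gt, pow_lt, Hd|lra]. }
    assert (H2 : E ^ 2 / Q ^ 2 <= M).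
    { replace (E ^ 2) with (Q ^ 2 + (1 - Cmod a ^ 2) * (1 - rho ^ 2)) by lra.
      replace ((Q ^ 2 + (1 - Cmod a ^ 2) * (1 - rho ^ 2)) / Q ^ 2)
        with (1 + (1 - Cmod a ^ 2) * (1 - rho ^ 2) / Q ^ 2) by (field; apply Rgt_not_eq; assumption).
      unfold M. apply Rplus_le_compat_l. unfold Rdiv. apply Rmult_le_compat.
      - apply Rmult_le_pos; nra.
      - left. apply Rinv_0_lt_compat, pow_lt, Hd'.
      - assert (0 <= Cmod a ^ 2 * (1 - rho ^ 2)); [|lra].
        apply Rmult_le_pos; [apply pow2_ge_0|nra].
      - apply Rinv_le_contravar; nra. }
    assert (H3 : 0 <= N ^ 2 / D ^ 2).
    { apply Rdiv_le_0_compat; [apply pow2_ge_0|apply pow_lt, Hd]. }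
    assert (H4 : 0 <= E ^ 2 / Q ^ 2).
    { apply Rdiv_le_0_compat; [apply pow2_ge_0|apply pow_lt, Hd']. }
    nra. }
  assert (Hga : Cmod (g a) = Cmod (C_derive phi a) * ((1 - Cmod a ^ 2) / (1 - Cmod b ^ 2))).
  { unfold g. rewrite slope_at, Cmod_mult. f_equal. fold b.
    assert (Hsq : forall c : C, Cmod c < 1 -> Cmod (1 - Cconj c * c) = 1 - Cmod c ^ 2).
    { intros c Hc. rewrite Cmult_comm, <- Cmod2_conj, <- RtoC_minus, Cmod_R.
      pose proof (Cmod_ge_0 c). apply Rabs_pos_eq. nra. }
    rewrite Cmod_mult, Cmod_inv by (apply blaschke_denominator; lra).
    rewrite !Hsq by assumption. reflexivity. }
  rewrite Hga in Hbound.
  assert (HD : 0 < 1 - Cmod b ^ 2) by nra.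
  set (X := Cmod (C_derive phi a) * ((1 - Cmod a ^ 2) / (1 - Cmod b ^ 2))) in *.
  assert (HX : X <= 1) by nra.
  replace ((1 - Cmod a ^ 2) * Cmod (C_derive phi a)) with (X * (1 - Cmod b ^ 2))
    by (unfold X; field; lra).
  nra.
Qed.

(** The strict version for c psi, then c tends to 1; this covers unimodular
    constants, which arise when w is a rotation. *)
Lemma schwarz_pick (psi : C -> C) (a : C) :
  (forall z, unit_disk z -> taylor 4 psi z) ->
  (forall z, unit_disk z -> Cmod (psi z) <= 1) -> unit_disk a ->
  (1 - Cmod a ^ 2) * Cmod (C_derive psi a) <= 1 - Cmod (psi a) ^ 2.
Proof.
  intros T Hpsi Ha.
  set (X := (1 - Cmod a ^ 2) * Cmod (C_derive psi a)).
  set (F := fun c => 1 - c * c * Cmod (psi a) ^ 2 - c * X).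
  cut (0 <= F 1); [unfold F; lra|].
  apply le_of_left_limit with (m := 0); [lra| |]; unfold F.
  { apply derivable_continuous_pt. reg. }
  intros c Hc.
  assert (Hmod : forall z, Cmod (c * z) = c * Cmod z).
  { intros z. rewrite Cmod_mult, Cmod_R, Rabs_pos_eq; lra. }
  pose proof (schwarz_pick_strict (fun z => c * psi z)%C a) as H.
  rewrite C_derive_mult, C_derive_const in H;
    [|apply taylor_const|apply taylor_le with (2 := T a Ha); auto with arith].
  replace (0 * psi a + c * C_derive psi a)%C with (c * C_derive psi a)%C in H by ring.
  rewrite !Hmod in H. unfold X.
  assert (H' : (1 - Cmod a ^ 2) * (c * Cmod (C_derive psi a)) <= 1 - (c * Cmod (psi a)) ^ 2).
  { apply H; [| |exact Ha].
    - intros z Hz. apply taylor_mult; [apply taylor_const|apply T, Hz].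
    - intros z Hz. rewrite Hmod. specialize (Hpsi z Hz). pose proof (Cmod_ge_0 (psi z)). nra. }
  lra.
Qed.

(** With psi = w(z) / z one has w' - w / z = z psi', so this is Schwarz-Pick
    for psi multiplied by |z|^2. *)
Lemma dieudonne (w : C -> C) (z : C) :
  (forall v, unit_disk v -> taylor 5 w v) ->
  (forall v, unit_disk v -> Cmod (w v) <= 1) -> w 0%C = 0%C ->
  unit_disk z -> z <> 0%C ->
  Cmod z * ((1 - Cmod z ^ 2) * Cmod (C_derive w z - w z / z)) <=
    Cmod z ^ 2 - Cmod (w z) ^ 2.
Proof.
  intros T Hw H0 Hz Hz0.
  assert (Tpsi : forall v, unit_disk v -> taylor 4 (slope w 0) v).
  { intros v Hv. apply taylor_slope; [|apply taylor_weaken, T, Hv].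
    apply T. unfold unit_disk. rewrite Cmod_0. lra. }
  pose proof (schwarz_pick (slope w 0) z Tpsi) as H.
  assert (Hfac : forall v, w v = (v * slope w 0 v)%C).
  { intros v. rewrite (slope_spec w 0 v) at 1. rewrite H0. ring. }
  assert (Hd : (C_derive w z - w z / z = z * C_derive (slope w 0) z)%C).
  { rewrite (C_derive_ext (fun v => v * slope w 0 v)%C w).
    - rewrite C_derive_mult, C_derive_id, (Hfac z).
      + field. exact Hz0.
      + apply taylor_id.
      + apply taylor_le with (2 := Tpsi z Hz). auto with arith.
    - apply near_all, Hfac.
    - apply taylor_mult; [apply taylor_id|].
      apply taylor_le with (2 := Tpsi z Hz). auto with arith. }
  rewrite Hd, Cmod_mult, (Hfac z), Cmod_mult.
  assert (Hs : (1 - Cmod z ^ 2) * Cmod (C_derive (slope w 0) z) <= 1 - Cmod (slope w 0 z) ^ 2).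
  { apply H; [|exact Hz]. apply schwarz; try assumption.
    intros v Hv. apply taylor_weaken, T, Hv. }
  pose proof (pow2_ge_0 (Cmod z)) as Hp.
  apply Rmult_le_compat_l with (r := Cmod z ^ 2) in Hs; [|exact Hp]. lra.
Qed.

(** * The complex exponential *)

Lemma exp_sub_1_upper (x : R) : exp x - 1 <= x * exp x.
Proof.
  pose proof (exp_ineq1_le (- x)) as H. rewrite exp_Ropp in H.
  pose proof (exp_pos x) as Hp.
  apply Rmult_le_compat_r with (r := exp x) in H; [|lra].
  rewrite Rinv_l in H by lra. lra.
Qed.

Lemma Rabs_sin_le (x : R) : Rabs (sin x) <= Rabs x.
Proof.
  destruct (MVT_gen sin 0 x cos) as (c & _ & Hc).
  - intros y _. apply is_derive_Reals, derivable_pt_lim_sin.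
  - intros y _. apply continuity_sin.
  - rewrite sin_0, !Rminus_0_r in Hc. rewrite Hc, Rabs_mult.
    pose proof (Rabs_pos x). assert (Rabs (cos c) <= 1) by (apply Rabs_le, COS_bound). nra.
Qed.

Lemma one_minus_cos_le (x : R) : 0 <= 1 - cos x <= x ^ 2 / 2.
Proof.
  pose proof (COS_bound x). split; [lra|].
  replace x with (2 * (x / 2)) at 1 by field. rewrite cos_2a_sin.
  pose proof (Rabs_sin_le (x / 2)) as H'. apply Rsqr_le_abs_1 in H'. unfold Rsqr in H'. lra.
Qed.

Lemma Rabs_sin_sub_le (x : R) : Rabs (sin x - x) <= Rabs x * x ^ 2 / 2.
Proof.
  destruct (MVT_gen (fun t => sin t - t) 0 x (fun t => cos t - 1)) as (c & Hc & Hv).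
  - intros y _. apply is_derive_Reals.
    apply (derivable_pt_lim_minus sin id); [apply derivable_pt_lim_sin|apply derivable_pt_lim_id].
  - intros y _. reg.
  - rewrite sin_0, !Rminus_0_r in Hv. rewrite Hv, Rabs_mult.
    pose proof (one_minus_cos_le c) as Hcos.
    assert (Hc2 : c ^ 2 <= x ^ 2).
    { destruct (Rle_lt_dec 0 x) as [Hx|Hx].
      - rewrite Rmin_left, Rmax_right in Hc by lra. nra.
      - rewrite Rmin_right, Rmax_left in Hc by lra. nra. }
    assert (Rabs (cos c - 1) <= x ^ 2 / 2) by (apply Rabs_le; lra).
    pose proof (Rabs_pos x). nra.
Qed.

Lemma Cexp_plus (z w : C) : Cexp (z + w) = (Cexp z * Cexp w)%C.
Proof.
  destruct z as [a b], w as [c d]. unfold Cexp, Re, Im. simpl.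
  rewrite exp_plus, cos_plus, sin_plus. unfold Cmult. simpl. f_equal; ring.
Qed.

Lemma Cexp_0 : Cexp 0 = 1%C.
Proof. unfold Cexp. simpl. rewrite exp_0, cos_0, sin_0. unfold RtoC. f_equal; ring. Qed.

Lemma Cexp_second_order (h : C) :
  Cmod h <= 1 -> Cmod (Cexp h - 1 - h) <= 10 * Cmod h ^ 2.
Proof.
  intros Hh. pose proof (Cmod2_alt h) as H2. pose proof (Cmod_ge_0 h) as H0.
  destruct h as [x y]. unfold Re, Im in H2. simpl fst in H2; simpl snd in H2.
  set (m := Cmod (x, y)) in *.
  assert (Hx : Rabs x <= 1 /\ Rabs y <= 1).
  { pose proof (Rmax_Cmod (x, y)) as H. simpl in H.
    pose proof (Rmax_l (Rabs x) (Rabs y)). pose proof (Rmax_r (Rabs x) (Rabs y)).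
    fold m in H. lra. }
  destruct Hx as [Hx Hy]. apply Rabs_le_between in Hx. apply Rabs_le_between in Hy.
  pose proof (exp_ineq1_le x) as E1. pose proof (exp_sub_1_upper x) as E2.
  pose proof (exp_pos x) as E0.
  assert (E3 : exp x <= 3).
  { apply Rle_trans with (exp 1); [|apply exp_le_3].
    destruct (Req_dec x 1) as [->|]; [lra|]. left. apply exp_increasing. lra. }
  assert (E4 : Rabs (exp x - 1) <= 3 * Rabs x).
  { destruct (Rle_lt_dec 0 x).
    - rewrite !Rabs_pos_eq by lra. nra.
    - rewrite !Rabs_left by nra. lra. }
  assert (E5 : 0 <= exp x - 1 - x <= 3 * x ^ 2) by nra.
  pose proof (one_minus_cos_le y) as C1. pose proof (Rabs_sin_sub_le y) as S1.
  assert (Hre : Rabs (exp x * cos y - 1 - x) <= 5 * m ^ 2).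
  { replace (exp x * cos y - 1 - x) with ((exp x - 1 - x) - exp x * (1 - cos y)) by ring.
    assert (0 <= exp x * (1 - cos y) <= 3 * (y ^ 2 / 2)).
    { split; [apply Rmult_le_pos; lra|apply Rmult_le_compat; lra]. }
    apply Rabs_le. pose proof (pow2_ge_0 x). pose proof (pow2_ge_0 y). lra. }
  assert (Him : Rabs (exp x * sin y - y) <= 5 * m ^ 2).
  { replace (exp x * sin y - y) with (exp x * (sin y - y) + (exp x - 1) * y) by ring.
    eapply Rle_trans; [apply Rabs_triang|]. rewrite !Rabs_mult, (Rabs_pos_eq (exp x)) by lra.
    assert (A1 : Rabs (sin y - y) <= y ^ 2 / 2).
    { assert (Rabs y <= 1) by (apply Rabs_le; lra). pose proof (pow2_ge_0 y). nra. }
    assert (A2 : exp x * Rabs (sin y - y) <= 3 * (y ^ 2 / 2)).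
    { apply Rmult_le_compat; try lra. apply Rabs_pos. }
    assert (A3 : Rabs (exp x - 1) * Rabs y <= 3 * Rabs x * Rabs y).
    { apply Rmult_le_compat_r; [apply Rabs_pos|exact E4]. }
    assert (A4 : 2 * (Rabs x * Rabs y) <= x ^ 2 + y ^ 2).
    { rewrite <- (pow2_abs x), <- (pow2_abs y).
      pose proof (pow2_ge_0 (Rabs x - Rabs y)). nra. }
    pose proof (pow2_ge_0 x). pose proof (pow2_ge_0 y). lra. }
  replace (Cexp (x, y) - 1 - (x, y))%C with
    (RtoC (exp x * cos y - 1 - x) + Ci * RtoC (exp x * sin y - y))%C.
  - eapply Rle_trans; [apply Cmod_triangle|]. rewrite Cmod_mult, Cmod_Ci, !Cmod_R. lra.
  - apply injective_projections; simpl; ring.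
Qed.

(** The addition formula transports the expansion at 0 to w. *)
Lemma Cexp_factor (w : C) : exists e1,
  (forall z, Cexp z = (Cexp w + (z - w) * e1 z)%C) /\ taylor 1 e1 w /\ e1 w = Cexp w.
Proof.
  set (k := fun h : C => if Ceq_dec h 0 then RtoC 0 else ((Cexp h - 1 - h) / (h * h))%C).
  assert (Hk : forall h, Cexp h = (1 + h * (1 + h * k h))%C).
  { intros h. unfold k. destruct (Ceq_dec h 0) as [->|H]; [rewrite Cexp_0; ring|].
    field. exact H. }
  exists (fun z => Cexp w * (1 + (z - w) * k (z - w)))%C. split; [|split].
  - intros z. replace z with (w + (z - w))%C at 1 by ring.
    rewrite Cexp_plus, (Hk (z - w)%C). ring.
  - apply taylor_S_intro with (fun z => Cexp w * k (z - w))%C (Cexp w).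
    { apply near_all. intros z. ring. }
    apply taylor_mult; [apply taylor_const|].
    exists 10. apply near_intro with 1; [lra|]. intros z Hz.
    unfold k. destruct (Ceq_dec (z - w) 0) as [H|H]; [rewrite Cmod_0; lra|].
    pose proof (Cexp_second_order (z - w) ltac:(lra)) as Hs.
    assert (Hp : 0 < Cmod (z - w)) by (apply Cmod_gt_0, H).
    rewrite Cmod_div by (apply Cmult_neq_0; exact H).
    rewrite (Cmod_mult (z - w)).
    apply Rle_div_l; [apply Rlt_gt; nra|]. simpl in Hs. lra.
  - ring.
Qed.

Lemma taylor_Cexp (w : C) : taylor 2 Cexp w.
Proof.
  destruct (Cexp_factor w) as (e1 & He & T & _).
  apply taylor_S_intro with e1 (Cexp w); [apply near_all, He|exact T].
Qed.

Lemma C_derive_Cexp (w : C) : C_derive Cexp w = Cexp w.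
Proof.
  destruct (Cexp_factor w) as (e1 & He & T & Hw).
  transitivity (e1 w); [|exact Hw].
  apply C_derive_taylor; [apply near_all, He|exact T].
Qed.

(** Equivalently, 2 cosh t - t^2 increases for t >= 0, as its derivative
    2 (sinh t - t) does. *)
Lemma even_exp_increasing (x y : R) :
  0 <= x <= y -> exp x + exp (- x) - x ^ 2 <= exp y + exp (- y) - y ^ 2.
Proof.
  intros Hxy.
  assert (D1 : forall t, 0 <= t -> 0 <= exp t - exp (- t) - 2 * t).
  { intros t Ht.
    destruct (MVT_gen (fun t => exp t - exp (- t) - 2 * t) 0 t
      (fun t => exp t + exp (- t) - 2)) as (c & _ & Hc).
    - intros s _. auto_derive; [exact I|ring].
    - intros s _. reg.
    - rewrite Ropp_0 in Hc.
      assert (0 <= exp c + exp (- c) - 2).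
      { pose proof (exp_pos c). rewrite exp_Ropp.
        replace (exp c + / exp c - 2) with ((exp c - 1) ^ 2 / exp c) by (field; lra).
        apply Rdiv_le_0_compat; [apply pow2_ge_0|lra]. }
      assert (0 <= (exp c + exp (- c) - 2) * (t - 0)) by (apply Rmult_le_pos; lra). lra. }
  destruct (MVT_gen (fun t => exp t + exp (- t) - t ^ 2) x y
    (fun t => exp t - exp (- t) - 2 * t)) as (c & Hc & Hv).
  - intros s _. auto_derive; [exact I|ring].
  - intros s _. reg.
  - rewrite Rmin_left, Rmax_right in Hc by lra.
    assert (0 <= (exp c - exp (- c) - 2 * c) * (y - x)).
    { apply Rmult_le_pos; [apply D1|]; lra. }
    lra.
Qed.

(** With w = x + iy and r = |w|, the square of the left side is at most
    (exp x - 1)^2 + exp x y^2, that is exp x (2 cosh x - 2 - x^2 + r^2).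
    Replacing x by r increases both factors and turns this into
    (exp r - 1)^2. *)
Lemma Cmod_Cexp_sub_1 (w : C) : Cmod (Cexp w - 1) <= exp (Cmod w) - 1.
Proof.
  pose proof (Cmod_ge_0 w) as Hr. set (r := Cmod w) in *.
  pose proof (Cmod2_alt w) as Hw. fold r in Hw.
  pose proof (re_le_Cmod w) as Hx. fold r in Hx.
  assert (He1 : 1 <= exp r) by (pose proof (exp_ineq1_le r); lra).
  destruct w as [x y]. unfold Re, Im in *. simpl fst in *; simpl snd in *.
  rewrite <- (sqrt_pow2 (Cmod _) (Cmod_ge_0 _)), <- (sqrt_pow2 (exp r - 1)) by lra.
  apply sqrt_le_1_alt. rewrite Cmod2_alt. unfold Cexp, Re, Im. simpl fst; simpl snd.
  pose proof (sin2_cos2 y) as Hsc. unfold Rsqr in Hsc.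
  pose proof (one_minus_cos_le y) as Hc. pose proof (exp_pos x) as Hp.
  apply Rle_trans with (exp x * (exp (Rabs x) + exp (- Rabs x) - Rabs x ^ 2 - 2 + r ^ 2)).
  - rewrite pow2_abs.
    assert (Hs : exp x * (exp (Rabs x) + exp (- Rabs x)) = exp x ^ 2 + 1).
    { destruct (Rle_lt_dec 0 x).
      - rewrite Rabs_pos_eq, exp_Ropp by lra. field. lra.
      - rewrite Rabs_left, Ropp_involutive, exp_Ropp by lra. field. lra. }
    replace (exp x * (exp (Rabs x) + exp (- Rabs x) - x ^ 2 - 2 + r ^ 2))
      with (exp x ^ 2 + 1 - 2 * exp x + exp x * y ^ 2) by (rewrite <- Hs; nra).
    assert (exp x * (1 - cos y) <= exp x * (y ^ 2 / 2)) by (apply Rmult_le_compat_l; lra).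
    assert (exp x ^ 2 * (sin y * sin y + cos y * cos y) = exp x ^ 2) by (rewrite Hsc; ring).
    nra.
  - pose proof (Rabs_pos x) as Ha.
    pose proof (even_exp_increasing (Rabs x) r ltac:(lra)) as Hm.
    assert (Hxr : exp x <= exp r).
    { assert (Hle : x <= r) by (pose proof (Rle_abs x); lra).
      destruct Hle as [Hlt|Heq]; [left; apply exp_increasing, Hlt|rewrite Heq; lra]. }
    apply Rle_trans with (exp x * (exp r + exp (- r) - 2)); [apply Rmult_le_compat_l; lra|].
    rewrite exp_Ropp.
    replace (exp r + / exp r - 2) with ((exp r - 1) ^ 2 / exp r) by (field; lra).
    replace ((exp r - 1) ^ 2) with (exp r * ((exp r - 1) ^ 2 / exp r)) at 2 by (field; lra).
    apply Rmult_le_compat_r; [|exact Hxr].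
    apply Rdiv_le_0_compat; [apply pow2_ge_0|lra].
Qed.

(** * The extremal problem in one and two real variables *)

(** The bound of the theorem as a function of t. *)
Definition profile (lambda t : R) : R :=
  (1 - t ^ 2) * (exp (lambda * t) + lambda * t - 1) / t.

Definition critical (lambda r : R) : R :=
  1 + r ^ 2 - 2 * lambda * r ^ 3
    - exp (lambda * r) * (1 - lambda * r + r ^ 2 + lambda * r ^ 3).

Lemma is_derive_profile (lambda t : R) :
  t <> 0 -> is_derive (profile lambda) t (critical lambda t / t ^ 2).
Proof.
  intros Ht. unfold profile, critical. auto_derive; [exact Ht|]. field. exact Ht.
Qed.

(** The difference of the two sides vanishes at 0 and has derivative
    exp t (t^2 + t^3) / 2. *)
Lemma exp_cubic_bound (x : R) : 0 <= x -> exp x * (x ^ 2 - 2 * x + 2) - 2 <= x ^ 3 * exp x / 2.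
Proof.
  intros Hx.
  destruct (MVT_gen (fun t => exp t * (t ^ 3 / 2 - t ^ 2 + 2 * t - 2)) 0 x
    (fun t => exp t * (t ^ 2 / 2 + t ^ 3 / 2))) as (c & Hc & Hv).
  - intros s _. auto_derive; [exact I|field].
  - intros s _. reg.
  - rewrite Rmin_left, Rmax_right in Hc by lra.
    rewrite exp_0 in Hv.
    assert (0 <= exp c * (c ^ 2 / 2 + c ^ 3 / 2) * (x - 0)).
    { pose proof (exp_pos c). pose proof (pow_le c 2 ltac:(lra)).
      pose proof (pow_le c 3 ltac:(lra)). repeat apply Rmult_le_pos; lra. }
    lra.
Qed.

Lemma exp_moment_bound (x : R) : 0 <= x -> x ^ 2 / 2 <= (x - 1) * exp x + 1.
Proof.
  intros Hx.
  destruct (MVT_gen (fun t => (t - 1) * exp t - t ^ 2 / 2) 0 x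
    (fun t => t * (exp t - 1))) as (c & Hc & Hv).
  - intros s _. auto_derive; [exact I|field].
  - intros s _. reg.
  - rewrite Rmin_left, Rmax_right in Hc by lra.
    rewrite exp_0 in Hv. pose proof (exp_ineq1_le c).
    assert (0 <= c * (exp c - 1) * (x - 0)) by (repeat apply Rmult_le_pos; lra).
    lra.
Qed.

(** This is the strict concavity of [profile].  With x = lambda t, the derivative
    of the ratio is K(t) / t^3 where
      K = exp x (x^2 - 2 x + 2) - 2 - t^2 (exp x (x^2 + 2 x) + 2 x).
    The first part is at most x^3 exp x / 2, and since lambda <= 2 one has
    t^2 >= x^2 / 4, so the term t^2 exp x (2 x) already absorbs it. *)
Lemma critical_ratio_decreasing (lambda s t : R) :
  0 < lambda <= 2 -> 0 < s < t ->
  critical lambda t / t ^ 2 < critical lambda s / s ^ 2.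
Proof.
  intros Hl Hst.
  set (K := fun t => exp (lambda * t) * (2 - 2 * (lambda * t) + (lambda * t) ^ 2
     - 2 * (lambda * t) * t ^ 2 - (lambda * t) ^ 2 * t ^ 2) - 2 - 2 * (lambda * t) * t ^ 2).
  destruct (MVT_gen (fun t => critical lambda t / t ^ 2) s t (fun t => K t / t ^ 3))
    as (c & Hc & Hv).
  - rewrite Rmin_left, Rmax_right by lra. intros y Hy. unfold critical, K.
    auto_derive; [nra|]. field. lra.
  - rewrite Rmin_left, Rmax_right by lra. intros y Hy. unfold critical.
    apply derivable_continuous_pt. reg. nra.
  - rewrite Rmin_left, Rmax_right in Hc by lra.
    assert (HK : K c < 0).
    { unfold K. set (x := lambda * c).
      assert (Hx : 0 < x) by (apply Rmult_lt_0_compat; lra).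
      pose proof (exp_cubic_bound x ltac:(lra)) as Hb. pose proof (exp_pos x) as Hp.
      assert (Hu : x ^ 2 / 4 <= c ^ 2).
      { unfold x. assert (lambda ^ 2 * c ^ 2 <= 4 * c ^ 2); [|lra].
        apply Rmult_le_compat_r; [apply pow2_ge_0|nra]. }
      assert (H1 : x ^ 2 / 4 * (exp x * (2 * x)) <= c ^ 2 * (exp x * (2 * x))).
      { apply Rmult_le_compat_r; [|exact Hu]. apply Rmult_le_pos; lra. }
      assert (H2 : 0 < c ^ 2 * (exp x * x ^ 2 + 2 * x)).
      { apply Rmult_lt_0_compat; [apply pow_lt; lra|].
        assert (0 < exp x * x ^ 2) by (apply Rmult_lt_0_compat; [lra|apply pow_lt, Hx]). lra. }
      lra. }
    assert (0 < c ^ 3) by (apply pow_lt; lra).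
    assert (Hq : 0 < - (K c / c ^ 3)).
    { replace (- (K c / c ^ 3)) with (- K c / c ^ 3) by (field; lra).
      apply Rdiv_lt_0_compat; lra. }
    assert (0 < - (K c / c ^ 3) * (t - s)) by (apply Rmult_lt_0_compat; lra).
    lra.
Qed.

(** The function behaves like lambda^2 t^2 / 2 at 0; the point lambda / 13 is
    small enough for the error, about 6 lambda t^3, to be dominated. *)
Lemma critical_pos_near_0 (lambda : R) :
  0 < lambda <= 2 -> 0 < critical lambda (lambda / 13).
Proof.
  intros Hl. set (t := lambda / 13). unfold critical.
  set (x := lambda * t).
  assert (Hx : x = lambda ^ 2 / 13) by (unfold x, t; field).
  assert (Hx0 : 0 < x < 1 / 2) by nra.
  assert (Ht : 0 < t ^ 2) by (apply pow_lt; unfold t; lra).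
  assert (He : exp x <= 1 + 2 * x).
  { pose proof (exp_sub_1_upper x). pose proof (exp_pos x). nra. }
  assert (Hm : x ^ 2 / 2 <= (x - 1) * exp x + 1) by (apply exp_moment_bound; lra).
  replace (1 + t ^ 2 - 2 * lambda * t ^ 3 - exp x * (1 - x + t ^ 2 + lambda * t ^ 3))
    with (((x - 1) * exp x + 1 - x ^ 2 / 2)
      + t ^ 2 * (lambda ^ 2 / 2 - (exp x * (1 + x) - 1 + 2 * x))) by (unfold x; field).
  assert (0 < t ^ 2 * (lambda ^ 2 / 2 - (exp x * (1 + x) - 1 + 2 * x))); [|lra].
  apply Rmult_lt_0_compat; [exact Ht|]. nra.
Qed.

Lemma critical_unique_root (lambda : R) :
  0 < lambda <= 2 ->
  exists t0, unique (fun r => 0 < r < 1 /\ critical lambda r = 0) t0.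
Proof.
  intros Hl.
  pose proof (critical_pos_near_0 lambda Hl) as H0.
  assert (H1 : critical lambda 1 < 0).
  { unfold critical. pose proof (exp_ineq1_le (lambda * 1)). lra. }
  destruct (IVT (fun r => - critical lambda r) (lambda / 13) 1) as (t0 & Ht & Hz).
  - intros r. unfold critical. reg.
  - lra.
  - lra.
  - lra.
  - assert (Hr : 0 < t0 < 1).
    { split; [lra|]. destruct Ht as [_ [Ht|Ht]]; [exact Ht|]. rewrite Ht in Hz. lra. }
    assert (Hz' : critical lambda t0 = 0) by lra.
    exists t0. split; [auto|]. intros t [Ht1 Ht2].
    destruct (Rtotal_order t0 t) as [Hlt|[Heq|Hgt]]; [|exact Heq|].
    + pose proof (critical_ratio_decreasing lambda t0 t Hl ltac:(lra)) as H.
      rewrite Hz', Ht2 in H. lra.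
    + pose proof (critical_ratio_decreasing lambda t t0 Hl ltac:(lra)) as H.
      rewrite Hz', Ht2 in H. lra.
Qed.

Lemma profile_le_max (lambda t0 s : R) :
  0 < lambda <= 2 -> 0 < t0 -> critical lambda t0 = 0 -> 0 < s ->
  profile lambda s <= profile lambda t0.
Proof.
  intros Hl Ht0 Hcrit Hs.
  destruct (MVT_gen (profile lambda) s t0 (fun t => critical lambda t / t ^ 2))
    as (c & Hc & Hv).
  - intros t Ht. apply is_derive_profile.
    assert (0 < Rmin s t0) by (apply Rmin_pos; assumption). lra.
  - intros t Ht. apply derivable_continuous_pt. exists (critical lambda t / t ^ 2).
    apply is_derive_Reals, is_derive_profile.
    assert (0 < Rmin s t0) by (apply Rmin_pos; assumption). lra.
  - assert (Hz : critical lambda t0 / t0 ^ 2 = 0) by (rewrite Hcrit; field; lra).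
    destruct (Rle_lt_dec s t0) as [H|H].
    + rewrite Rmin_left, Rmax_right in Hc by lra.
      assert (0 <= critical lambda c / c ^ 2).
      { destruct (Req_dec c t0) as [->|Hne]; [lra|]. rewrite <- Hz. left.
        apply critical_ratio_decreasing; lra. }
      assert (0 <= critical lambda c / c ^ 2 * (t0 - s)) by (apply Rmult_le_pos; lra). lra.
    + rewrite Rmin_right, Rmax_left in Hc by lra.
      assert (critical lambda c / c ^ 2 <= 0).
      { destruct (Req_dec c t0) as [->|Hne]; [lra|]. rewrite <- Hz. left.
        apply critical_ratio_decreasing; lra. }
      assert (0 <= - (critical lambda c / c ^ 2) * (s - t0)) by (apply Rmult_le_pos; lra). lra.
Qed.

(** The function tends to 2 lambda at 0. *)
Lemma profile_max_ge (lambda t0 : R) :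
  0 < lambda <= 2 -> 0 < t0 -> critical lambda t0 = 0 ->
  2 * lambda <= profile lambda t0.
Proof.
  intros Hl Ht0 Hcrit.
  set (F := fun rho => profile lambda t0 - 2 * lambda * (1 - (1 - rho) * (1 - rho))).
  cut (0 <= F 1); [unfold F; lra|].
  apply le_of_left_limit with (m := 0); [lra| |]; unfold F.
  { apply derivable_continuous_pt. reg. }
  intros rho Hrho.
  pose proof (profile_le_max lambda t0 (1 - rho) Hl Ht0 Hcrit ltac:(lra)) as H.
  assert (2 * lambda * (1 - (1 - rho) * (1 - rho)) <= profile lambda (1 - rho)); [|lra].
  unfold profile. set (t := 1 - rho) in *. assert (Ht : 0 < t < 1) by (unfold t; lra).
  pose proof (exp_ineq1_le (lambda * t)) as He.
  apply (Rle_div_r _ _ t); [lra|].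
  replace (2 * lambda * (1 - t * t) * t) with ((1 - t ^ 2) * (2 * (lambda * t))) by ring.
  apply Rmult_le_compat_l; [nra|lra].
Qed.

(** With A = exp (lambda s) + lambda s - 1, the difference of the two sides is
    (r - s) / (r s) times A - lambda s^2 + r s (A - lambda), and
    A >= 2 lambda s outweighs lambda s^2 + lambda r s. *)
Lemma bound_le_diagonal (lambda r s : R) :
  0 < lambda -> 0 < s <= r -> r <= 1 ->
  ((1 - r ^ 2) * (exp (lambda * s) + lambda * s - 1) + lambda * (r ^ 2 - s ^ 2)) / r
    <= profile lambda s.
Proof.
  intros Hl Hs Hr. unfold profile.
  pose proof (exp_ineq1_le (lambda * s)) as He.
  set (A := exp (lambda * s) + lambda * s - 1) in *.
  assert (HA : 2 * (lambda * s) <= A) by (unfold A; lra).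
  assert (H : 0 <= (r - s) * ((A - lambda * s ^ 2) + s * r * (A - lambda))).
  { apply Rmult_le_pos; [lra|].
    assert (0 <= lambda * s) by (apply Rmult_le_pos; lra).
    assert (0 <= s * r * A) by (repeat apply Rmult_le_pos; lra).
    assert (lambda * s * s <= lambda * s * 1) by (apply Rmult_le_compat_l; lra).
    assert (lambda * s * r <= lambda * s * 1) by (apply Rmult_le_compat_l; lra).
    lra. }
  apply (Rle_div_l _ _ r); [lra|].
  replace ((1 - s ^ 2) * A / s * r) with ((1 - s ^ 2) * A * r / s) by (field; lra).
  apply (Rle_div_r _ _ s); [lra|]. lra.
Qed.

(** * Pre-Schwarzians of the class and the norm estimate *)

Lemma is_derive_Re_line (f : C -> C) (c z0 : C) (t : R) :
  taylor 2 f (z0 + t)%C ->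
  is_derive (fun s : R => Re (c * f (z0 + s)%C)) t (Re (c * C_derive f (z0 + t)%C)).
Proof.
  intros T. apply is_derive_Reals.
  destruct (taylor_derive _ _ _ T) as (f1 & Hf & T1 & <-).
  intros eps Heps. pose proof (Cmod_ge_0 c) as Hc.
  assert (He : 0 < eps / (Cmod c + 1)) by (apply Rdiv_lt_0_compat; lra).
  destruct (near_elim _ _ (near_and _ _ _ Hf (taylor_continuous _ _ _ T1 He)))
    as (d & Hd & Hn).
  exists (mkposreal d Hd). intros h Hh Hhd. simpl in Hhd.
  assert (E : (z0 + (t + h)%R - (z0 + t) = h)%C) by (rewrite RtoC_plus; ring).
  destruct (Hn (z0 + (t + h)%R)%C) as [-> Hb]; [rewrite E, Cmod_R; exact Hhd|].
  rewrite E. set (w := f1 (z0 + (t + h)%R)%C) in *.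
  set (w0 := f1 (z0 + t)%C) in *. set (v := f (z0 + t)%C).
  replace ((Re (c * (v + h * w)) - Re (c * v)) / h - Re (c * w0)) with (Re (c * (w - w0))).
  - eapply Rle_lt_trans; [apply re_le_Cmod|]. rewrite Cmod_mult.
    apply Rle_lt_trans with ((Cmod c + 1) * Cmod (w - w0)).
    { pose proof (Cmod_ge_0 (w - w0)). nra. }
    apply Rmult_lt_compat_l with (r := Cmod c + 1) in Hb; [|lra].
    replace ((Cmod c + 1) * (eps / (Cmod c + 1))) with eps in Hb by (field; lra). exact Hb.
  - clearbody w w0 v. destruct c as [c1 c2], w as [w1 w2], w0 as [u1 u2], v as [v1 v2].
    simpl. field. exact Hh.
Qed.

Lemma is_derive_sub_quadratic (g : R -> R) (A B s l : R) :
  is_derive g s l -> is_derive (fun t => g t - A * t - B * t ^ 2 / 2) s (l - A - B * s).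
Proof.
  intros Hg. auto_derive; [exists l; exact Hg|].
  assert (E : Derive (fun t : R => g t) s = l) by (apply is_derive_unique; exact Hg).
  rewrite E. field.
Qed.

(** The second Taylor coefficient is half of the second derivative.  An
    expansion at one point says nothing on nearby derivatives, so this needs a
    mean value argument: along the horizontal line through z0, apply it to the
    real part of conj v (f(z0 + t) - p0 t - L t^2 / 2), where v is the assumed
    discrepancy between the two sides.  The increment is about |v|^2 x^2,
    whereas its derivative is o(t). *)
Lemma C_derive_slope_at (f : C -> C) (z0 : C) :
  near z0 (taylor 2 f) -> taylor 3 f z0 -> taylor 2 (C_derive f) z0 ->
  C_derive (slope f z0) z0 = (C_derive (C_derive f) z0 / 2)%C.
Proof.
  intros Hnear T3 Tp.
  destruct (taylor_derive _ _ _ (taylor_slope_at _ _ _ T3)) as (k1 & Hk & Tk & <-).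
  destruct (taylor_derive _ _ _ Tp) as (p1 & Hp & Tp1 & <-).
  set (L := p1 z0) in *. set (a := k1 z0) in *.
  (* the claim is that this discrepancy vanishes *)
  set (v := (a - L / 2)%C).
  destruct (Ceq_dec v 0) as [Hv|Hv]; [apply Cminus_eq_0, Hv|exfalso].
  apply Cmod_gt_0 in Hv.
  assert (He : 0 < Cmod v / 4) by lra.
  destruct (near_elim _ _ (near_and _ _ _ Hnear (near_and _ _ _
     (near_and _ _ _ Hk (taylor_continuous _ _ _ Tk He))
     (near_and _ _ _ Hp (taylor_continuous _ _ _ Tp1 He))))) as (d & Hd & Hn).
  fold a L in Hn. set (p0 := C_derive f z0) in *.
  assert (Hn' : forall t : R, Rabs t < d -> taylor 2 f (z0 + t)%C /\
    (exists k : C, f (z0 + t)%C = (f z0 + t * (p0 + t * k))%C /\ Cmod (k - a) < Cmod v / 4) /\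
    (exists p : C, C_derive f (z0 + t)%C = (p0 + t * p)%C /\ Cmod (p - L) < Cmod v / 4)).
  { intros t Ht. assert (E : (z0 + t - z0 = t)%C) by ring.
    destruct (Hn (z0 + t)%C) as (H1 & (H2 & H3) & H4 & H5).
    { rewrite E, Cmod_R. exact Ht. }
    rewrite E in H2, H4. split; [exact H1|split].
    - exists (k1 (z0 + t)%C). split; [|exact H3].
      rewrite (slope_spec f z0 (z0 + t)%C), E, H2, slope_at. reflexivity.
    - exists (p1 (z0 + t)%C). split; [exact H4|exact H5]. }
  clear Hn.
  set (c := Cconj v). assert (Hc : Cmod c = Cmod v) by apply Cmod_conj.
  set (x := d / 2). assert (Hx : 0 < x < d) by (unfold x; lra).
  set (g := fun s : R => Re (c * f (z0 + s)%C)).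
  assert (Hg : forall s, Rabs s < d -> is_derive g s (Re (c * C_derive f (z0 + s)%C))).
  { intros s Hs. apply is_derive_Re_line, Hn', Hs. }
  assert (Hphi : forall s, 0 <= s <= x ->
    is_derive (fun s => g s - Re (c * p0) * s - Re (c * L) * s ^ 2 / 2) s
      (Re (c * C_derive f (z0 + s)%C) - Re (c * p0) - Re (c * L) * s)).
  { intros s Hs. apply is_derive_sub_quadratic, Hg. rewrite Rabs_pos_eq; lra. }
  destruct (MVT_gen (fun s => g s - Re (c * p0) * s - Re (c * L) * s ^ 2 / 2) 0 x
    (fun s => Re (c * C_derive f (z0 + s)%C) - Re (c * p0) - Re (c * L) * s))
    as (y & Hy & Hmvt).
  - rewrite Rmin_left, Rmax_right by lra. intros s Hs. apply Hphi. lra.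
  - rewrite Rmin_left, Rmax_right by lra. intros s Hs.
    apply derivable_continuous_pt. eexists. apply is_derive_Reals, Hphi, Hs.
  - rewrite Rmin_left, Rmax_right in Hy by lra.
    destruct (Hn' x ltac:(rewrite Rabs_pos_eq; lra)) as (_ & (k & Hfx & Hk') & _).
    destruct (Hn' y ltac:(rewrite Rabs_pos_eq; lra)) as (_ & _ & p & Hpy & Hp').
    assert (E1 : Re (c * C_derive f (z0 + y)%C) - Re (c * p0) - Re (c * L) * y
      = y * Re (c * (p - L))).
    { rewrite Hpy. generalize c p0 p L. intros [c1 c2] [u1 u2] [v1 v2] [l1 l2]. simpl. ring. }
    assert (E2 : g x - Re (c * p0) * x - Re (c * L) * x ^ 2 / 2
        - (g 0 - Re (c * p0) * 0 - Re (c * L) * 0 ^ 2 / 2)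
      = x ^ 2 * (Cmod v ^ 2 + Re (c * (k - a)))).
    { unfold g. rewrite Hfx. replace (z0 + 0)%C with z0 by ring.
      rewrite Cmod2_alt. unfold c.
      assert (Ea : a = (v + L / 2)%C) by (unfold v; ring). rewrite Ea.
      generalize v (f z0) p0 L k. clear.
      intros [c1 c2] [u1 u2] [v1 v2] [l1 l2] [k1 k2]. simpl. field. }
    rewrite E1, E2 in Hmvt.
    assert (B : forall q : C, Cmod q < Cmod v / 4 -> Rabs (Re (c * q)) <= Cmod v ^ 2 / 4).
    { intros q Hq. eapply Rle_trans; [apply re_le_Cmod|]. rewrite Cmod_mult, Hc. nra. }
    pose proof (B _ Hk') as B1. pose proof (B _ Hp') as B2.
    apply Rabs_le_between in B1. apply Rabs_le_between in B2.
    assert (Hv2 : 0 < Cmod v ^ 2) by (apply pow_lt, Hv).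
    set (X1 := Re (c * (k - a))) in *. set (X2 := Re (c * (p - L))) in *.
    assert (y * X2 <= x * (Cmod v ^ 2 / 4)) by nra.
    assert (y * X2 * x <= x * (Cmod v ^ 2 / 4) * x) by (apply Rmult_le_compat_r; lra).
    assert (0 < x ^ 2) by (apply pow_lt; lra).
    assert (x ^ 2 * (Cmod v ^ 2 * 3 / 4) <= x ^ 2 * (Cmod v ^ 2 + X1))
      by (apply Rmult_le_compat_l; lra).
    assert (0 < x ^ 2 * Cmod v ^ 2) by (apply Rmult_lt_0_compat; assumption).
    lra.
Qed.

(** Written with f(z) / z in place of f, the differential equation holds at 0 as
    well, and can be differentiated there. *)
Lemma C_derive_starlike (lambda : R) (f w : C -> C) :
  f 0%C = 0%C -> C_derive f 0%C = 1%C -> w 0%C = 0%C ->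
  (forall z, unit_disk z -> z <> 0%C -> f z <> 0%C) ->
  (forall z, unit_disk z -> starlike_quotient f z = Cexp (lambda * w z)) ->
  forall z, unit_disk z -> C_derive f z = (slope f 0 z * Cexp (lambda * w z))%C.
Proof.
  intros Hf0 Hf1 Hw0 Hne Hq z Hz.
  destruct (Ceq_dec z 0) as [->|Hz0].
  - rewrite slope_at, Hw0, Hf1. replace (lambda * 0)%C with (RtoC 0) by ring.
    rewrite Cexp_0. ring.
  - rewrite <- (Hq z Hz). unfold starlike_quotient.
    destruct (Ceq_dec z 0) as [H|_]; [contradiction|].
    rewrite slope_neq, Hf0 by exact Hz0.
    replace (f z - 0)%C with (f z) by ring. replace (z - 0)%C with z by ring.
    field. split; [apply Hne; assumption|exact Hz0].
Qed.

Lemma taylor_exp_comp (lambda : R) (w : C -> C) (z : C) :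
  taylor 3 w z -> taylor 2 (fun v => Cexp (lambda * w v)) z.
Proof.
  intros T. apply (taylor_comp 2 Cexp (fun v => lambda * w v)%C).
  - apply taylor_Cexp.
  - apply taylor_mult; [apply taylor_const|exact T].
Qed.

Lemma C_derive_exp_comp (lambda : R) (w : C -> C) (z : C) :
  taylor 3 w z ->
  C_derive (fun v => Cexp (lambda * w v)) z =
    (lambda * C_derive w z * Cexp (lambda * w z))%C.
Proof.
  intros T. apply taylor_weaken in T.
  rewrite (C_derive_comp Cexp (fun v => lambda * w v)%C).
  - rewrite C_derive_mult, C_derive_const, C_derive_Cexp; [ring|apply taylor_const|exact T].
  - apply taylor_Cexp.
  - apply taylor_mult; [apply taylor_const|exact T].
Qed.

Lemma second_derivative_starlike (lambda : R) (f w : C -> C) :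
  analytic_on unit_disk f -> analytic_on unit_disk w ->
  (forall z, unit_disk z -> C_derive f z = (slope f 0 z * Cexp (lambda * w z))%C) ->
  forall z, unit_disk z -> taylor 2 (C_derive f) z /\
    C_derive (C_derive f) z =
      ((C_derive (slope f 0) z + slope f 0 z * (lambda * C_derive w z))
        * Cexp (lambda * w z))%C.
Proof.
  intros Af Aw Hd z Hz.
  assert (D0 : unit_disk 0) by (unfold unit_disk; rewrite Cmod_0; lra).
  assert (Tk : taylor 2 (slope f 0) z).
  { apply taylor_slope; apply taylor_analytic, Af; assumption. }
  assert (Tw : taylor 3 w z) by (apply taylor_analytic, Aw, Hz).
  pose proof (taylor_exp_comp lambda w z Tw) as Te.
  assert (T : taylor 2 (fun v => slope f 0 v * Cexp (lambda * w v))%C z)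
    by (apply taylor_mult; assumption).
  assert (Hn : near z (fun v => C_derive f v = (slope f 0 v * Cexp (lambda * w v))%C))
    by exact (near_imp _ _ _ Hd (near_unit_disk z Hz)).
  split; [exact (taylor_ext _ _ _ _ Hn T)|].
  rewrite (C_derive_ext _ _ _ Hn T), C_derive_mult by assumption.
  rewrite C_derive_exp_comp by exact Tw. ring.
Qed.

(** Put k = f(z) / z.  Then f' = k exp (lambda w) = k + z k', and the two
    expressions together give k' / k = (exp (lambda w) - 1) / z. *)
Lemma pre_schwarzian_starlike (lambda : R) (f w : C -> C) :
  analytic_on unit_disk f -> analytic_on unit_disk w -> f 0%C = 0%C ->
  (forall z, unit_disk z -> z <> 0%C -> f z <> 0%C) ->
  (forall z, unit_disk z -> C_derive f z = (slope f 0 z * Cexp (lambda * w z))%C) ->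
  forall z, unit_disk z -> z <> 0%C ->
    pre_schwarzian f z = ((Cexp (lambda * w z) - 1) / z + lambda * C_derive w z)%C.
Proof.
  intros Af Aw Hf0 Hne Hd z Hz Hz0.
  assert (D0 : unit_disk 0) by (unfold unit_disk; rewrite Cmod_0; lra).
  assert (Tk : taylor 2 (slope f 0) z).
  { apply taylor_slope; apply taylor_analytic, Af; assumption. }
  assert (Hfac : forall v, f v = (v * slope f 0 v)%C).
  { intros v. rewrite (slope_spec f 0 v) at 1. rewrite Hf0. ring. }
  assert (Hd1 : C_derive f z = (slope f 0 z + z * C_derive (slope f 0) z)%C).
  { rewrite (C_derive_ext (fun v => v * slope f 0 v)%C f).
    - rewrite C_derive_mult, C_derive_id by (assumption || apply taylor_id). ring.
    - apply near_all, Hfac.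
    - apply taylor_mult; [apply taylor_id|exact Tk]. }
  destruct (second_derivative_starlike lambda f w Af Aw Hd z Hz) as [_ Hd2].
  unfold pre_schwarzian. rewrite Hd2, (Hd z Hz).
  rewrite (Hd z Hz) in Hd1.
  specialize (Hne z Hz Hz0). rewrite Hfac in Hne.
  assert (Hk : slope f 0 z <> 0%C) by (intros H; apply Hne; rewrite H; ring).
  pose proof (Cexp_neq_0 (lambda * w z)) as He.
  set (k := slope f 0 z) in *. set (e := Cexp (lambda * w z)) in *.
  assert (Hk' : C_derive (slope f 0) z = (k * (e - 1) / z)%C).
  { replace (k * (e - 1))%C with (z * C_derive (slope f 0) z)%C
      by (replace (k * (e - 1))%C with (k * e - k)%C by ring; rewrite Hd1; ring).
    field. exact Hz0. }
  rewrite Hk'. field. repeat split; assumption.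
Qed.

(** Here f''(0) = k'(0) + lambda w'(0) with k = f(z) / z, and k'(0) is
    f''(0) / 2. *)
Lemma pre_schwarzian_starlike_0 (lambda : R) (f w : C -> C) :
  analytic_on unit_disk f -> analytic_on unit_disk w ->
  C_derive f 0%C = 1%C -> w 0%C = 0%C ->
  (forall z, unit_disk z -> C_derive f z = (slope f 0 z * Cexp (lambda * w z))%C) ->
  pre_schwarzian f 0 = (2 * lambda * C_derive w 0)%C.
Proof.
  intros Af Aw Hf1 Hw0 Hd.
  assert (D0 : unit_disk 0) by (unfold unit_disk; rewrite Cmod_0; lra).
  destruct (second_derivative_starlike lambda f w Af Aw Hd 0%C D0) as [Tp Hd2].
  rewrite slope_at, Hf1, Hw0, C_derive_slope_at in Hd2; [| | |exact Tp].
  - replace (lambda * 0)%C with (RtoC 0) in Hd2 by ring. rewrite Cexp_0 in Hd2.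
    unfold pre_schwarzian. rewrite Hf1. set (L := C_derive (C_derive f) 0) in *.
    replace (L / 1)%C with (2 * (L - L / 2))%C by field.
    rewrite Hd2 at 1. field.
  - apply near_imp with (2 := near_unit_disk 0 D0).
    intros z Hz. apply taylor_analytic, Af, Hz.
  - apply taylor_analytic, Af, D0.
Qed.

Lemma pre_schwarzian_bound (lambda : R) (z p w d : C) :
  0 < lambda -> 0 < Cmod z < 1 ->
  p = ((Cexp (lambda * w) - 1) / z + lambda * d)%C ->
  Cmod z * ((1 - Cmod z ^ 2) * Cmod (d - w / z)) <= Cmod z ^ 2 - Cmod w ^ 2 ->
  (1 - Cmod z ^ 2) * Cmod p <=
    ((1 - Cmod z ^ 2) * (exp (lambda * Cmod w) + lambda * Cmod w - 1)
      + lambda * (Cmod z ^ 2 - Cmod w ^ 2)) / Cmod z.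
Proof.
  intros Hl Hz -> Hd.
  assert (Hz0 : z <> 0%C) by (apply Cmod_gt_0; lra).
  assert (Hlm : forall v, Cmod (lambda * v) = lambda * Cmod v).
  { intros v. rewrite Cmod_mult, Cmod_R, Rabs_pos_eq; lra. }
  assert (H : Cmod ((Cexp (lambda * w) - 1) / z + lambda * d) <=
    (exp (lambda * Cmod w) - 1) / Cmod z + lambda * Cmod w / Cmod z
      + lambda * Cmod (d - w / z)).
  { replace ((Cexp (lambda * w) - 1) / z + lambda * d)%C with
      ((Cexp (lambda * w) - 1) / z + lambda * w / z + lambda * (d - w / z))%C
      by (field; exact Hz0).
    eapply Rle_trans; [apply Cmod_triangle|].
    rewrite Hlm. apply Rplus_le_compat_r.
    eapply Rle_trans; [apply Cmod_triangle|].
    rewrite !Cmod_div, Hlm by exact Hz0.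
    apply Rplus_le_compat_r, Rmult_le_compat_r; [left; apply Rinv_0_lt_compat; lra|].
    rewrite <- Hlm. apply Cmod_Cexp_sub_1. }
  set (r := Cmod z) in *. set (s := Cmod w) in *. set (q := Cmod (d - w / z)) in *.
  apply (Rle_div_r _ _ r); [lra|].
  apply Rmult_le_compat_l with (r := (1 - r ^ 2) * r) in H; [|apply Rmult_le_pos; nra].
  replace ((1 - r ^ 2) * r * ((exp (lambda * s) - 1) / r + lambda * s / r + lambda * q))
    with ((1 - r ^ 2) * (exp (lambda * s) + lambda * s - 1) + lambda * (r * ((1 - r ^ 2) * q)))
    in H by (field; lra).
  apply Rmult_le_compat_l with (r := lambda) in Hd; lra.
Qed.

Theorem corollary4p2 (lambda : R) (f : C -> C)
    (hlambda : 0 < lambda < PI / 2) (hf : starlike_exp lambda f) :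
  exists t0 : R,
    unique (fun r : R => 0 < r < 1 /\
      1 + r ^ 2 - 2 * lambda * r ^ 3
        - exp (lambda * r) * (1 - lambda * r + r ^ 2 + lambda * r ^ 3) = 0) t0 /\
    Rbar_le (pre_schwarzian_norm f)
      (Finite ((1 - t0 ^ 2) * (exp (lambda * t0) + lambda * t0 - 1) / t0)).
Proof.
  assert (Hl : 0 < lambda <= 2) by (pose proof PI_4; lra).
  destruct (critical_unique_root lambda Hl) as (t0 & [[Ht0 Hcrit] Huniq]).
  exists t0. split; [split; [split; assumption|exact Huniq]|].
  destruct hf as [[Af [Hf0 Hf1]] [Hne (w & Aw & Hw & Hw0 & Hq)]].
  pose proof (C_derive_starlike lambda f w Hf0 Hf1 Hw0 Hne Hq) as Hd.
  assert (Tw : forall n z, unit_disk z -> taylor n w z).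
  { intros n z Hz. apply taylor_analytic, Aw, Hz. }
  assert (Hw1 : forall z, unit_disk z -> Cmod (w z) <= 1).
  { intros z Hz. left. apply Hw, Hz. }
  pose proof (schwarz w (Tw 4%nat) Hw1 Hw0) as Hslope.
  pose proof (profile_max_ge lambda t0 Hl (proj1 Ht0) Hcrit) as Hmax.
  apply (proj2 (Lub_Rbar_correct _)). intros y (z & Hz & ->). simpl.
  change ((1 - Cmod z ^ 2) * Cmod (pre_schwarzian f z) <= profile lambda t0).
  destruct (Ceq_dec z 0) as [->|Hz0].
  - rewrite (pre_schwarzian_starlike_0 lambda f w Af Aw Hf1 Hw0 Hd).
    specialize (Hslope _ Hz). rewrite slope_at in Hslope.
    rewrite !Cmod_mult, Cmod_0, !Cmod_R, !Rabs_pos_eq by lra.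
    assert (lambda * Cmod (C_derive w 0) <= lambda * 1) by (apply Rmult_le_compat_l; lra).
    lra.
  - pose proof Hz as Hz1. unfold unit_disk in Hz1.
    assert (Hzp : 0 < Cmod z) by (apply Cmod_gt_0, Hz0).
    assert (Hwz : Cmod (w z) <= Cmod z).
    { rewrite (slope_spec w 0 z), Hw0.
      replace (0 + (z - 0) * slope w 0 z)%C with (z * slope w 0 z)%C by ring.
      rewrite Cmod_mult. specialize (Hslope z Hz). nra. }
    eapply Rle_trans.
    { apply (pre_schwarzian_bound lambda z _ (w z) (C_derive w z)); [lra|lra| |].
      - apply pre_schwarzian_starlike; assumption.
      - apply dieudonne; auto. }
    destruct (Cmod_ge_0 (w z)) as [Hs|Hs].
    + eapply Rle_trans; [apply bound_le_diagonal; lra|].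
      apply profile_le_max; lra.
    (* w z = 0 leaves only lambda |z|, below the limit 2 lambda of the profile *)
    + rewrite <- Hs, Rmult_0_r, exp_0. apply (Rle_div_l _ _ (Cmod z)); [lra|].
      assert (lambda * Cmod z * Cmod z <= lambda * Cmod z * 1) by (apply Rmult_le_compat_l; nra).
      assert (2 * lambda * Cmod z <= profile lambda t0 * Cmod z) by (apply Rmult_le_compat_r; lra).
      nra.
Qed.
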